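(* Define $K:[0,1]\times[0,1]\to\mathbb{R}$ by $K(x,y)=\frac{1}{2}-\left\{\frac{1}{xy}\right\}$ for $0<x,y\le 1$, and $K(x,y)=0$ when $0\le x,y\le 1$ and $xy=0$, where $\{t\}=t-\lfloor t\rfloor\in[0,1)$ denotes the fractional part of $t\in\mathbb{R}$. Let $\mathcal{S}(K)$ be the set of eigenvalues of $K$. Then each of the sets $\mathcal{S}(K)\cap(-\infty,0)$ and $\mathcal{S}(K)\cap(0,\infty)$ is infinite.
   Context: A number $\lambda\neq 0$ is an eigenvalue of $K$ if there exists a Lebesgue measurable function $\phi$ on $[0,1]$ with $0<\int_0^1|\phi(x)|^2\,dx<\infty$ such that $\phi(x)=\lambda\int_0^1 K(x,y)\phi(y)\,dy$ for almost every $x\in[0,1]$ (with respect to Lebesgue measure). Since $K$ is a symmetric square-integrable kernel, all its eigenvalues are real. *)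

(* Defs.v *)
From HB Require Import structures.
From mathcomp Require Import all_boot all_order all_algebra.
From mathcomp Require Import all_classical all_reals all_analysis.
From mathcomp Require Import complex.

Set Implicit Arguments.
Unset Strict Implicit.
Unset Printing Implicit Defensive.

Import Order.TTheory GRing.Theory Num.Theory numFieldNormedType.Exports.

Local Open Scope classical_set_scope.
Local Open Scope ring_scope.
Local Open Scope complex_scope.

(* [completed_lebesgue_measure] is used rather than [lebesgue_measure], which
   lives on the Borel sigma-algebra only: functions are Lebesgue measurable. *)
Notation lebesgueTypeR R :=
  (caratheodory_type (mu_ext (wlength (@idfun (Real.sort R))))).

Section Eigenvalues.
Context {R : realType}.

Notation mu := (@completed_lebesgue_measure R).
Notation I := (`[0, 1]%classic : set R).

Definition cmeasurable01 (phi : R -> R[i]) : Prop :=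
  measurable_fun (I : set (lebesgueTypeR R)) (@complex.Re R \o phi) /\
  measurable_fun (I : set (lebesgueTypeR R)) (@complex.Im R \o phi).

(* [Rintegral] takes a junk value on non-integrable functions; for the bounded
   kernel below and square-integrable [phi] this never occurs. *)
Definition cintegral01 (f : R -> R[i]) : R[i] :=
  Rintegral mu I (@complex.Re R \o f) +i* Rintegral mu I (@complex.Im R \o f).

(* Eigenvalues and eigenfunctions are a priori complex; functions on [0, 1] are
   functions on R of which only the restriction to [0, 1] is used. *)
Definition eigenvalue_of (K : R -> R -> R) (lambda : R[i]) : Prop :=
  lambda != 0 /\
  exists phi : R -> R[i],
    [/\ cmeasurable01 phi,
        (0 < \int[mu]_(x in I) (Normc.normc (phi x) ^+ 2)%:E)%E,
        (\int[mu]_(x in I) (Normc.normc (phi x) ^+ 2)%:E < +oo)%E &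
        {ae mu, forall x, I x ->
           phi x = lambda * cintegral01 (fun y => (K x y)%:C * phi y)}].

Definition eigenvalues (K : R -> R -> R) : set R[i] :=
  [set lambda | eigenvalue_of K lambda].

Definition fracpart (t : R) : R := t - (Num.floor t)%:~R.

Definition kernel_frac (x y : R) : R :=
  if x * y == 0 then 0 else 1 / 2 - fracpart (1 / (x * y)).

End Eigenvalues.

(* Main.v *)
(**
Let s = 1 or -1 and let T be the integral operator with kernel sK.

If phi_1, ..., phi_N are orthonormal eigenfunctions of T with positive
eigenvalues nu_i, then T has a further one, orthogonal to all of them, as soon
as the form <T f, f> takes a positive value on their orthogonal complement:
the supremum M of the form on the unit sphere of the complement is attained.
Indeed, M - T is nonnegative there, so a maximizing sequence f_n satisfies
|M f_n - T f_n| -> 0, while |T f (x) - T f (x')| <= |K(x,.) - K(x',.)| |f| and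
the L^2-separability of {K(x,.)} give a subsequence along which T f_n converges
pointwise, hence in L^2 because T f_n is bounded by 1.  As the limit of M f_n
is bounded too, one never leaves the bounded measurable functions and no
completeness of L^2 is needed.  By Bessel's inequality the sum of the nu_i^2 is
at most 1, so these eigenfunctions have infinitely many distinct eigenvalues.

It remains to find arbitrarily large spaces on which the form is positive.  For
x, y close to 1/sqrt 2,
  K(x,y) = 3/2 - 1/(xy) + 1_{xy <= 1/2},
where the first two terms have rank one.  Take step functions w_k = r_k - s l_k,
with r_k supported to the right of 1/sqrt 2, l_k supported to the left of it and
near the image of the support of r_k under the reflection x |-> 1/(2x), and r_k,
l_k both of mean zero.  The term 3/2 then contributes nothing, and the last term
makes the w_k orthogonal with <T w_k, w_k> > 0 up to the rank one term, which
costs one more linear condition.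
*)

Require Import Defs.
From mathcomp Require Import all_boot all_order all_algebra.
From mathcomp Require Import all_classical all_reals all_analysis.
From mathcomp Require Import complex.
From mathcomp Require Import measurable_realfun zify ring lra.

Set Implicit Arguments.
Unset Strict Implicit.
Unset Printing Implicit Defensive.

Import Order.TTheory GRing.Theory Num.Theory numFieldNormedType.Exports.

Local Open Scope classical_set_scope.
Local Open Scope ring_scope.

(** * Means of bounded measurable functions *)

Section BoundedMeasurable.
Context {d : measure_display} {T : measurableType d} {R : realType}.
Implicit Types f g : T -> R.

(** The bound holds everywhere, not almost everywhere, so no quotient by null sets enters. Such
    functions are stable under sums and products, and integrable for a probability. *)
Definition bmeas f := measurable_fun setT f /\ exists C : R, forall x, `|f x| <= C.

Lemma bmeas_cst (c : R) : bmeas (fun=> c).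
Proof. by split; [exact: measurable_cst | exists `|c|]. Qed.

Lemma bmeasD f g : bmeas f -> bmeas g -> bmeas (fun x => f x + g x).
Proof.
move=> [mf [A fA]] [mg [B gB]]; split; first exact: measurable_funD.
by exists (A + B) => x; rewrite (le_trans (ler_normD _ _))// lerD.
Qed.

Lemma bmeasM f g : bmeas f -> bmeas g -> bmeas (fun x => f x * g x).
Proof.
move=> [mf [A fA]] [mg [B gB]]; split; first exact: measurable_funM.
by exists (A * B) => x; rewrite normrM ler_pM.
Qed.

Lemma bmeasN f : bmeas f -> bmeas (fun x => - f x).
Proof.
move=> /(bmeasM (bmeas_cst (-1))); congr bmeas.
by apply/funext => x; rewrite mulN1r.
Qed.

Lemma bmeasB f g : bmeas f -> bmeas g -> bmeas (fun x => f x - g x).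
Proof. by move=> bf /bmeasN; exact: bmeasD. Qed.

Lemma bmeasX f n : bmeas f -> bmeas (fun x => f x ^+ n).
Proof.
move=> bf; elim: n => [|n IHn]; first exact: bmeas_cst.
have -> : (fun x => f x ^+ n.+1) = (fun x => f x * f x ^+ n).
  by apply/funext => x; rewrite exprS.
exact: bmeasM.
Qed.

Lemma bmeas_sum (I : Type) (r : seq I) (F : I -> T -> R) :
  (forall i, bmeas (F i)) -> bmeas (fun x => \sum_(i <- r) F i x).
Proof.
move=> bF; elim: r => [|i r IHr].
  have -> : (fun x => \sum_(i <- [::]) F i x) = (fun=> 0).
    by apply/funext => x; rewrite big_nil.
  exact: bmeas_cst.
have -> : (fun x => \sum_(i <- i :: r) F i x) = (fun x => F i x + \sum_(i <- r) F i x).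
  by apply/funext => x; rewrite big_cons.
exact: bmeasD.
Qed.

End BoundedMeasurable.

Ltac bmeas := lazymatch goal with
  | |- forall _, _ => intro; bmeas
  | |- bmeas (fun _ => ?c) => exact: bmeas_cst
  | |- bmeas (fun x => @?f x + - @?g x) => apply: (@bmeasB _ _ _ f g); bmeas
  | |- bmeas (fun x => @?f x + @?g x) => apply: (@bmeasD _ _ _ f g); bmeas
  | |- bmeas (fun x => - @?f x) => apply: (@bmeasN _ _ _ f); bmeas
  | |- bmeas (fun x => @?f x * @?g x) => apply: (@bmeasM _ _ _ f g); bmeas
  | |- bmeas (fun x => @?f x ^+ ?n) => apply: (@bmeasX _ _ _ f n); bmeas
  | |- bmeas (fun x => \sum_(i <- _) @?F x i) =>
      refine (@bmeas_sum _ _ _ _ _ (fun i x => F x i) _); bmeas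
  | |- _ => first [ by auto | match goal with H : _ |- _ => exact: H end ]
  end.

Section Mean.
Context {d : measure_display} {T : measurableType d} {R : realType}.
Variable P : probability T R.
Implicit Types f g : T -> R.

Definition mean f : R := \int[P]_x f x.

Lemma bmeas_integrable f : bmeas f -> P.-integrable setT (EFin \o f).
Proof.
move=> [mf [C fC]]; apply: measurable_bounded_integrable => //.
- by apply: le_lt_trans (probability_le1 P measurableT) _; rewrite ltry.
- exists `|C|; split=> // x /= Cx y _.
  by rewrite (le_trans (fC y))// (le_trans (ler_norm _))// ltW.
Qed.

Lemma mean_EFin f : bmeas f -> (\int[P]_x (f x)%:E)%E = (mean f)%:E.
Proof. by move=> /bmeas_integrable bf; rewrite fineK//; exact: integrable_fin_num. Qed.

Lemma meanD f g : bmeas f -> bmeas g -> mean (fun x => f x + g x) = mean f + mean g.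
Proof. by move=> bf bg; rewrite /mean RintegralD//; exact: bmeas_integrable. Qed.

Lemma meanZ c f : bmeas f -> mean (fun x => c * f x) = c * mean f.
Proof. by move=> bf; rewrite /mean RintegralZl//; exact: bmeas_integrable. Qed.

Lemma meanB f g : bmeas f -> bmeas g -> mean (fun x => f x - g x) = mean f - mean g.
Proof. by move=> bf bg; rewrite /mean RintegralB//; exact: bmeas_integrable. Qed.

Lemma mean_cst c : mean (fun=> c) = c.
Proof.
rewrite /mean Rintegral_cst//.
have -> : fine (P setT) = 1 by rewrite probability_setT.
by rewrite mulr1.
Qed.

Lemma mean_sum (I : Type) (r : seq I) (F : I -> T -> R) : (forall i, bmeas (F i)) ->
  mean (fun x => \sum_(i <- r) F i x) = \sum_(i <- r) mean (F i).
Proof.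
move=> bF; elim: r => [|i r IHr].
  rewrite big_nil -[RHS](mean_cst 0); congr mean.
  by apply/funext => x; rewrite big_nil.
rewrite big_cons -IHr -meanD//; last bmeas; congr mean.
by apply/funext => x; rewrite big_cons.
Qed.

Lemma mean_ge0 f : (forall x, 0 <= f x) -> 0 <= mean f.
Proof. by move=> f0; apply: Rintegral_ge0 => x _. Qed.

Lemma ler_mean f g : bmeas f -> bmeas g -> (forall x, f x <= g x) -> mean f <= mean g.
Proof. by move=> bf bg fg; apply: le_Rintegral => //; exact: bmeas_integrable. Qed.

Lemma mean_norm_le f c : bmeas f -> (forall x, `|f x| <= c) -> `|mean f| <= c.
Proof.
move=> bf fc; rewrite ler_norml -(mean_cst c) -[X in - X <= _]/(mean (fun=> c)).
have -> : - mean (fun=> c) = mean (fun=> - c) by rewrite !mean_cst.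
by apply/andP; split; apply: ler_mean; try bmeas; move=> x; have := fc x;
  rewrite ler_norml => /andP[].
Qed.

Lemma mean_cvg_ae (f_ : nat -> T -> R) f c : (forall n, bmeas (f_ n)) -> bmeas f ->
  (forall n x, `|f_ n x| <= c) -> {ae P, forall x, f_ ^~ x @ \oo --> f x} ->
  mean (f_ n) @[n --> \oo] --> mean f.
Proof.
move=> bf bdf fc ff.
have [] := @dominated_convergence _ T R P setT measurableT
  (fun n => EFin \o f_ n) (EFin \o f) (EFin \o (fun=> c)).
- by move=> n; apply/measurable_EFinP; case: (bf n).
- by apply/measurable_EFinP; case: bdf.
- by apply: filterS ff => x fx _; apply: cvg_EFin; [exact: nearW | exact: fx].
- exact: bmeas_integrable (bmeas_cst c).
- by apply: aeW => x n _; rewrite /= lee_fin.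
move=> _ _.
rewrite [X in _ --> X -> _](mean_EFin bdf) => /fine_cvg.
by apply: cvg_trans; apply: near_eq_cvg; apply: nearW => n; rewrite /mean /Rintegral.
Qed.

Lemma mean_cvg (f_ : nat -> T -> R) f c : (forall n, bmeas (f_ n)) ->
  (forall n x, `|f_ n x| <= c) -> (forall x, f_ ^~ x @ \oo --> f x) ->
  bmeas f /\ mean (f_ n) @[n --> \oo] --> mean f.
Proof.
move=> bf fc ff.
have mf : measurable_fun setT f.
  by apply: (measurable_fun_cvg (h := f_)) => [n|x _]; [case: (bf n)|exact: ff].
have bdf : bmeas f.
  split=> //; exists c => x.
  have : `|f_ n x| @[n --> \oo] --> `|f x| by apply: cvg_norm; exact: ff.
  by move=> h; apply: (closed_cvg (fun y => y <= c) (@closed_le R c) _ _ h); exact: nearW.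
by split=> //; apply: mean_cvg_ae fc _ => //; exact: aeW.
Qed.

Lemma bmeas_mean (F : T -> T -> R) c : measurable_fun setT (fun z => F z.1 z.2) ->
  (forall x y, `|F x y| <= c) -> bmeas (fun x => mean (F x)).
Proof.
move=> mF Fc.
have bF x : bmeas (F x).
  by split; [exact: (measurableT_comp mF (pair1_measurable x)) | exists c].
split; last by exists c => x; exact: mean_norm_le.
have iF : (P \x P)%E.-integrable setT (EFin \o (fun z => F z.1 z.2)).
  apply: measurable_bounded_integrable => //.
    by apply: le_lt_trans (probability_le1 (P \x P)%E measurableT) _; rewrite ltry.
  exists `|c|; split=> // x /= Cx y _.
  by rewrite (le_trans (Fc _ _))// (le_trans (ler_norm _))// ltW.
apply/measurable_EFinP.
have -> : EFin \o (fun x => mean (F x)) = (fun x => (\int[P]_y (F x y)%:E)%E).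
  by apply/funext => x; rewrite /= -mean_EFin.
exact: (measurable_fubini_F iF).
Qed.

Lemma mean_fubini (F : T -> T -> R) c : measurable_fun setT (fun z => F z.1 z.2) ->
  (forall x y, `|F x y| <= c) ->
  mean (fun x => mean (F x)) = mean (fun y => mean (F ^~ y)).
Proof.
move=> mF Fc.
have bF x : bmeas (F x).
  by split; [exact: (measurableT_comp mF (pair1_measurable x)) | exists c].
have bF' y : bmeas (F ^~ y).
  by split; [exact: (measurableT_comp mF (pair2_measurable y)) | exists c].
have iF : (P \x P)%E.-integrable setT (EFin \o (fun z => F z.1 z.2)).
  apply: measurable_bounded_integrable => //.
    by apply: le_lt_trans (probability_le1 (P \x P)%E measurableT) _; rewrite ltry.
  exists `|c|; split=> // x /= Cx y _.
  by rewrite (le_trans (Fc _ _))// (le_trans (ler_norm _))// ltW.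
rewrite /mean /Rintegral; congr fine.
transitivity (\int[P]_x \int[P]_y (F x y)%:E)%E.
  by apply: eq_integral => x _; rewrite (mean_EFin (bF x)).
rewrite (Fubini iF).
by apply: eq_integral => x _; rewrite -(mean_EFin (bF' x)).
Qed.

End Mean.
(** Tychonoff on the product of countably many copies of [-1, 1] gives a cluster point [p] of the
    sequence of rows. Then [phi n] is any index past [n] whose first [n] coordinates are within
    1/(n+1) of [p]. The bound [n <= phi n] replaces strict monotonicity. *)
Lemma diag_subseq {R : realType} (u : nat -> nat -> R) : (forall n i, `|u n i| <= 1) ->
  exists phi : nat -> nat, (forall n, (n <= phi n)%N) /\
  exists p : nat -> R, forall i, u (phi n) i @[n --> \oo] --> p i.
Proof.
move=> u1.
have := @tychonoff nat (fun=> R) (fun=> `[-1, 1]%classic) (fun=> @segment_compact R (-1) 1).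
move=> /(_ (fmap u \oo) _)[|p [_ clp]].
  by exists 0%N => // n _ i /=; rewrite in_itv/= -ler_norml.
have near_p n : \forall f \near p, forall i, (i < n)%N -> `|p i - f i| < n.+1%:R^-1.
  have near_pi i : \forall f \near p, `|p i - f i| < n.+1%:R^-1.
    have e0 : 0 < n.+1%:R^-1 :> R by rewrite invr_gt0.
    exact: (@proj_continuous nat (fun=> R) i p _ (nbhsx_ballx (p i) _ e0)).
  have H m : \forall f \near p, forall i, (i < m)%N -> `|p i - f i| < n.+1%:R^-1.
    elim: m => [|m IHm]; first by apply: filterE => f i; rewrite ltn0.
    apply: filterS2 IHm (near_pi m) => f fH fm i.
    by rewrite ltnS leq_eqVlt => /orP[/eqP->|/fH].
  exact: H.
have phiP n : exists m, (n <= m)%N /\ forall i, (i < n)%N -> `|p i - u m i| < n.+1%:R^-1.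
  have tail : fmap u \oo (u @` [set m | (n <= m)%N]).
    by exists n => // m /= nm; exists m.
  by have [_ [[m /= nm <-] um]] := clp _ _ tail (near_p n); exists m.
have [phi phiH] := choice phiP.
exists phi; split=> [n|]; first by have [] := phiH n.
exists p => i; apply/cvgrPdist_lt => e e0.
near=> n.
have [_ /(_ i)] := phiH n.
have ni : (i < n)%N by near: n; exact: nbhs_infty_gt.
move=> /(_ ni) /lt_trans; apply.
near: n; exact: near_infty_natSinv_lt (PosNum e0).
Unshelve. all: by end_near.
Qed.

(** * The L^2 inner product of bounded functions *)

Section Dot.
Context {d : measure_display} {T : measurableType d} {R : realType}.
Variable P : probability T R.
Implicit Types f g h : T -> R.

Definition inner f g : R := mean P (fun x => f x * g x).

Local Notation dot := inner.

Lemma dotC f g : dot f g = dot g f.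
Proof. by congr mean; apply/funext => x; rewrite mulrC. Qed.

Lemma dotDl f g h : bmeas f -> bmeas g -> bmeas h ->
  dot (fun x => f x + g x) h = dot f h + dot g h.
Proof.
move=> bf bg bh; rewrite /inner -meanD; [|bmeas|bmeas].
by congr mean; apply/funext => x; rewrite mulrDl.
Qed.

Lemma dotZl c f g : bmeas f -> bmeas g -> dot (fun x => c * f x) g = c * dot f g.
Proof.
move=> bf bg; rewrite /inner -meanZ; last bmeas.
by congr mean; apply/funext => x; rewrite mulrA.
Qed.

Lemma dotBl f g h : bmeas f -> bmeas g -> bmeas h ->
  dot (fun x => f x - g x) h = dot f h - dot g h.
Proof.
move=> bf bg bh; rewrite /inner -meanB; [|bmeas|bmeas].
by congr mean; apply/funext => x; rewrite mulrBl.
Qed.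

Lemma dotDr f g h : bmeas f -> bmeas g -> bmeas h ->
  dot f (fun x => g x + h x) = dot f g + dot f h.
Proof. by move=> bf bg bh; rewrite dotC dotDl// !(dotC f). Qed.

Lemma dotBr f g h : bmeas f -> bmeas g -> bmeas h ->
  dot f (fun x => g x - h x) = dot f g - dot f h.
Proof. by move=> bf bg bh; rewrite dotC dotBl// !(dotC f). Qed.

Lemma dotZr c f g : bmeas f -> bmeas g -> dot f (fun x => c * g x) = c * dot f g.
Proof. by move=> bf bg; rewrite dotC dotZl// dotC. Qed.

Lemma dot_suml (I : Type) (r : seq I) (F : I -> T -> R) g :
  (forall i, bmeas (F i)) -> bmeas g ->
  dot (fun x => \sum_(i <- r) F i x) g = \sum_(i <- r) dot (F i) g.
Proof.
move=> bF bg; rewrite /inner -mean_sum; last by move=> i; bmeas.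
by congr mean; apply/funext => x; rewrite mulr_suml.
Qed.

Lemma dot_ge0 f : 0 <= dot f f.
Proof. by apply: mean_ge0 => x; rewrite -expr2 sqr_ge0. Qed.

Lemma cauchy_schwarz f g : bmeas f -> bmeas g -> dot f g ^+ 2 <= dot f f * dot g g.
Proof.
move=> bf bg; set a := dot f f; set b := dot f g; set c := dot g g.
have sqr_dist s t : 0 <= s ^+ 2 * c - 2 * s * t * b + t ^+ 2 * a.
  have := dot_ge0 (fun x => s * g x - t * f x).
  rewrite dotBl; [|bmeas..]; rewrite !dotBr; [|bmeas..].
  rewrite !dotZl; [|bmeas..]; rewrite !dotZr; [|bmeas..].
  rewrite (dotC g f) -/a -/b -/c => /le_trans; apply; rewrite le_eqVlt.
  by apply/orP; left; apply/eqP; ring.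
have a0 : 0 <= a := dot_ge0 f.
have c0 : 0 <= c := dot_ge0 g.
move: a0; rewrite le_eqVlt => /predU1P[a0|a0].
  (* If f has norm zero, these coefficients leave -(c + 2) b^2 >= 0, with c + 2 > 0, which forces b
     = 0. *)
  have := sqr_dist b (c + 1); rewrite -a0 mul0r mulr0 addr0.
  have -> : b ^+ 2 * c - 2 * b * (c + 1) * b = - ((c + 2) * b ^+ 2) by ring.
  by rewrite oppr_ge0 pmulr_rle0// ltr_pwDr.
have := sqr_dist a b.
have -> : a ^+ 2 * c - 2 * a * b * b + b ^+ 2 * a = a * (a * c - b ^+ 2) by ring.
by rewrite pmulr_rge0// subr_ge0.
Qed.

Lemma dot_norm_le f c : bmeas f -> (forall x, f x ^+ 2 <= c) -> dot f f <= c.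
Proof.
move=> bf fc; rewrite -[leRHS](mean_cst P); apply: ler_mean; [bmeas|bmeas|].
by move=> x; rewrite -expr2.
Qed.

Lemma dotD_le f g : bmeas f -> bmeas g ->
  dot (fun x => f x + g x) (fun x => f x + g x) <= 2 * (dot f f + dot g g).
Proof.
move=> bf bg; have := dot_ge0 (fun x => f x - g x).
rewrite !dotBl; [|bmeas..]; rewrite !dotBr; [|bmeas..].
rewrite !dotDl; [|bmeas..]; rewrite !dotDr; [|bmeas..].
rewrite (dotC g f); lra.
Qed.

End Dot.

Lemma le0_of_cvg0 {R : realType} (u : nat -> R) (x c : R) :
  u n @[n --> \oo] --> 0 -> (forall n, x <= c * u n) -> x <= 0.
Proof.
move=> u0 xu; rewrite -(mulr0 c).
have cu : c * u n @[n --> \oo] --> c * 0 by apply: cvgMr.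
by apply: (closed_cvg (fun y => x <= y) (@closed_ge R x) _ _ cu); exact: nearW.
Qed.

(** * Positive eigenvalues of a symmetric integral operator *)

Section Operator.
Context {d : measure_display} {T : measurableType d} {R : realType}.
Variable P : probability T R.
Implicit Types f g h : T -> R.
Local Notation dot := (inner P).
Variable k : T -> T -> R.

Definition integral_op f x : R := dot (k x) f.
Local Notation kop := integral_op.

Hypothesis mk : measurable_fun setT (fun z : T * T => k z.1 z.2).
Hypothesis ksym : forall x y, k x y = k y x.
Hypothesis k_le1 : forall x y, `|k x y| <= 1.

Lemma bmeas_k x : bmeas (k x).
Proof. by split; [exact: (measurableT_comp mk (pair1_measurable x)) | exists 1]. Qed.

Let mkf f : bmeas f -> measurable_fun setT (fun z : T * T => k z.1 z.2 * f z.2).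
Proof.
move=> [mf _]; apply: measurable_funM => //.
exact: (measurableT_comp mf measurable_snd).
Qed.

Lemma bmeas_integral_op f : bmeas f -> bmeas (kop f).
Proof.
move=> bf; have [_ [C fC]] := bf.
apply: (@bmeas_mean _ _ _ P (fun x y => k x y * f y) C (mkf bf)) => x y.
by rewrite normrM -[C]mul1r ler_pM.
Qed.

Lemma integral_op_sym f g : bmeas f -> bmeas g -> dot (kop f) g = dot f (kop g).
Proof.
move=> bf bg; have [_ [C fC]] := bf; have [mg [D gD]] := bg.
have bk x := bmeas_k x.
transitivity (mean P (fun x => mean P (fun y => g x * (k x y * f y)))).
  by congr mean; apply/funext => x; rewrite mulrC meanZ//; bmeas.
rewrite (@mean_fubini _ _ _ P _ (D * (1 * C))); last 2 first.
- apply: measurable_funM; last exact: mkf.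
  exact: (measurableT_comp mg measurable_fst).
- by move=> x y; rewrite !normrM !ler_pM// mulr_ge0.
congr mean; apply/funext => y; rewrite /integral_op /inner.
rewrite -meanZ; last by have := bk y; bmeas.
congr mean; apply/funext => x.
by rewrite ksym; ring.
Qed.

Lemma integral_opB f g x : bmeas f -> bmeas g -> kop (fun x => f x - g x) x = kop f x - kop g x.
Proof. by move=> bf bg; rewrite /integral_op dotBr//; exact: bmeas_k. Qed.

Lemma integral_opZ c f x : bmeas f -> kop (fun x => c * f x) x = c * kop f x.
Proof. by move=> bf; rewrite /integral_op dotZr//; exact: bmeas_k. Qed.

Lemma dot_k_le1 x : dot (k x) (k x) <= 1.
Proof.
apply: (dot_norm_le P (bmeas_k x)) => y.
by rewrite -real_normK ?num_real// expr_le1.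
Qed.

(** Pointwise Cauchy-Schwarz against the section [k x], of norm at most 1. It bounds the images of
    unit vectors uniformly, and turns L^2 convergence to 0 into convergence of the images at every
    point. *)
Lemma integral_op_le f x : bmeas f -> kop f x ^+ 2 <= dot f f.
Proof.
move=> bf; apply: le_trans (cauchy_schwarz P (bmeas_k x) bf) _.
by rewrite -[leRHS]mul1r ler_wpM2r ?dot_ge0 ?dot_k_le1.
Qed.

Lemma integral_op_norm_le f : bmeas f -> dot (kop f) (kop f) <= dot f f.
Proof. by move=> bf; apply: dot_norm_le (bmeas_integral_op bf) _ => x; exact: integral_op_le. Qed.

Lemma norm_form_le f : bmeas f -> `|dot (kop f) f| <= dot f f.
Proof.
move=> bf; have bkf := bmeas_integral_op bf.
rewrite -(@ler_pXn2r _ 2)// ?nnegrE ?dot_ge0//.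
rewrite real_normK ?num_real// (le_trans (cauchy_schwarz P bkf bf))// expr2.
by rewrite ler_wpM2r ?dot_ge0// integral_op_norm_le.
Qed.

(** * Maximizing the form on an orthogonal complement *)

Section MaxEigen.
Variables (I : Type) (g : I -> T -> R) (mu : I -> R).
Hypothesis bg : forall i, bmeas (g i).
Hypothesis eig_g : forall i x, kop (g i) x = mu i * g i x.
Variable q : nat -> T.
Hypothesis qdense : forall x e, 0 < e ->
  exists i, dot (fun y => k x y - k (q i) y) (fun y => k x y - k (q i) y) < e.

Let V f := bmeas f /\ forall i, dot f (g i) = 0.

Let V_kop f : V f -> V (kop f).
Proof.
move=> [bf fg]; split; [exact: bmeas_integral_op|move=> i].
rewrite integral_op_sym//; have -> : kop (g i) = (fun x => mu i * g i x) by apply/funext.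
by rewrite dotZr// fg mulr0.
Qed.

Let V_lin a f b h : V f -> V h -> V (fun x => a * f x - b * h x).
Proof.
move=> [bf fg] [bh hg]; split=> [|i]; first bmeas.
by rewrite dotBl ?dotZl//; [rewrite fg hg; ring|bmeas|bmeas].
Qed.

Let unitforms := [set dot (kop f) f | f in [set f | V f /\ dot f f = 1]].
Let M := sup unitforms.

Let ubM : has_ubound unitforms.
Proof.
exists 1 => _ [f [[bf _] f1] <-].
by rewrite (le_trans (ler_norm _))// (le_trans (norm_form_le bf))// f1.
Qed.

Let form_le f : V f -> dot (kop f) f <= M * dot f f.
Proof.
move=> Vf; have [bf _] := Vf; have := dot_ge0 P f.
rewrite le_eqVlt => /predU1P[f0|f0].
  by rewrite -f0 mulr0 (le_trans (ler_norm _))// (le_trans (norm_form_le bf))// -f0.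
pose c := (Num.sqrt (dot f f))^-1.
have c2 : c ^+ 2 = (dot f f)^-1 by rewrite exprVn sqr_sqrtr// ltW.
have bcf : bmeas (fun x => c * f x) by bmeas.
have : dot (kop (fun x => c * f x)) (fun x => c * f x) <= M.
  apply: ub_le_sup => //; exists (fun x => c * f x) => //; split.
    have := V_lin c 0 Vf Vf; congr V; apply/funext => x; ring.
  by rewrite dotZl// dotZr// mulrA -expr2 c2 mulVf// gt_eqF.
have -> : kop (fun x => c * f x) = (fun x => c * kop f x).
  by apply/funext => x; rewrite integral_opZ.
have bkf := bmeas_integral_op bf.
rewrite dotZl// dotZr// mulrA -expr2 c2 mulrC ler_pdivrMr//.
Qed.

(* Compare the form at [f] and at [f - h / (M + 1)], [h] being the residual. *)
Let residual_le f : V f -> dot f f = 1 -> 0 < M ->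
  dot (fun x => M * f x - kop f x) (fun x => M * f x - kop f x)
    <= (M + 1) * (M - dot (kop f) f).
Proof.
move=> Vf f1 M0; set h := (fun x => _); have [bf _] := Vf.
have bkf := bmeas_integral_op bf.
have Vh : V h.
  have := V_lin M 1 Vf (V_kop Vf); congr V; apply/funext => x; rewrite /h; ring.
have hhE : dot h h = M * dot f h - dot (kop f) h.
  have [bh _] := Vh; rewrite {1}/h dotBl ?dotZl//; bmeas.
(* The body of [h] is forgotten, so that the bilinear expansions below treat it as an atom; [hhE] is
   all that is needed from it. *)
move: h Vh hhE => h Vh hhE.
have [bh _] := Vh; have bkh := bmeas_integral_op bh.
pose t := (M + 1)^-1.
have M1 : 0 < M + 1 by lra.
have t0 : 0 < t by rewrite invr_gt0.
have tM : t * (M + 1) = 1 by rewrite mulVf// gt_eqF.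
have Vfh : V (fun x => 1 * f x - t * h x) by exact: V_lin.
have := form_le Vfh.
have -> : kop (fun x => 1 * f x - t * h x) = (fun x => 1 * kop f x - t * kop h x).
  by apply/funext => x; rewrite integral_opB ?integral_opZ//; bmeas.
rewrite !dotBl; [|bmeas..]; rewrite !dotBr; [|bmeas..].
rewrite !dotZl; [|bmeas..]; rewrite !dotZr; [|bmeas..].
have khf : dot (kop h) f = dot (kop f) h by rewrite integral_op_sym// dotC.
have khh : - dot h h <= dot (kop h) h.
  by rewrite lerNl (le_trans (ler_norm _))// normrN norm_form_le.
rewrite khf (dotC P h f) f1.
set a := dot (kop f) f in hhE *; set b := dot f h in hhE *.
set c := dot (kop f) h in hhE *; set e := dot h h in hhE khh *.
set s := dot (kop h) h in khh *.
move=> H.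
(* This is the expanded inequality for f - t h, where [hhE] merges the two linear terms into 2 t e.
   As s >= - e, the quadratic term is at least - t^2 (M + 1) e, which is - t e for t = 1 / (M + 1);
   one t e is left over. *)
have H1 : a + 2 * t * e + t ^+ 2 * (s - M * e) <= M.
  rewrite -subr_ge0; move: H; rewrite -subr_ge0 => /le_trans; apply.
  by rewrite le_eqVlt; apply/orP; left; apply/eqP; rewrite hhE; ring.
have H2 : t ^+ 2 * (- (M + 1) * e) <= t ^+ 2 * (s - M * e).
  by rewrite ler_wpM2l ?sqr_ge0//; lra.
have H3 : t * e <= M - a.
  have E2 : t ^+ 2 * (- (M + 1) * e) = - (t * e).
    transitivity (- (t * (M + 1)) * (t * e)); first ring.
    by rewrite tM; ring.
  by lra.
have -> : e = (M + 1) * (t * e) by rewrite mulrA (mulrC _ t) tM mul1r.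
by rewrite ler_wpM2l// ltW.
Qed.

(** Since each [f n] has norm 1, Cauchy-Schwarz bounds the gap between the images at x and at [q i]
    by the distance of the two sections, uniformly in n. Convergence at the points [q i] thus makes
    the values at x a Cauchy sequence. *)
Let pointwise_cvg (f : nat -> T -> R) : (forall n, bmeas (f n)) ->
  (forall n, dot (f n) (f n) = 1) ->
  (forall i, cvgn (fun n => kop (f n) (q i))) ->
  forall x, cvgn (fun n => kop (f n) x).
Proof.
move=> bf f1 fq x; apply/cauchy_cvgP/cauchy_exP => e e0.
have e20 : 0 < e / 2 by rewrite divr_gt0.
have [i +] := qdense x (exprn_gt0 2 e20).
have bkx := bmeas_k x; have bki := bmeas_k (q i).
set D := (fun y => _); set l := limn (fun n => kop (f n) (q i)) => De.
have bD : bmeas D by rewrite /D; bmeas.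
exists l; rewrite /fmapE -ball_normE /ball_/=.
have /cvgrPdist_lt /(_ _ e20) := fq i.
apply: filterS => n; rewrite -/l => ln.
suff kn : `|kop (f n) (q i) - kop (f n) x| < e / 2.
  apply: (le_lt_trans (ler_distD (kop (f n) (q i)) _ _)).
  by rewrite (splitr e) ltrD.
rewrite distrC -(@ltr_pXn2r _ 2)// ?nnegrE ?(ltW e20)//.
rewrite real_normK ?num_real// (le_lt_trans _ De)//.
rewrite /integral_op -dotBl//; apply: le_trans (cauchy_schwarz P bD (bf n)) _.
by rewrite f1 mulr1.
Qed.

Lemma max_eigen : (exists w, V w /\ 0 < dot (kop w) w) ->
  exists f nu, [/\ bmeas f, dot f f = 1, forall i, dot f (g i) = 0, 0 < nu &
    forall x, kop f x = nu * f x].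
Proof.
move=> [w [Vw w0]].
have [bw _] := Vw.
have ww0 : 0 < dot w w by rewrite (lt_le_trans w0)// (le_trans (ler_norm _))// norm_form_le.
have M0 : 0 < M by rewrite -(pmulr_lgt0 _ ww0) (lt_le_trans w0)// form_le.
have supM : has_sup unitforms.
  split=> //; pose c := (Num.sqrt (dot w w))^-1.
  exists (dot (kop (fun x => c * w x)) (fun x => c * w x)), (fun x => c * w x) => //=.
  split; last first.
    rewrite dotZl ?dotZr//; last bmeas.
    by rewrite mulrA -expr2 exprVn sqr_sqrtr ?dot_ge0// mulVf// gt_eqF.
  by have := V_lin c 0 Vw Vw; congr V; apply/funext => x; ring.
have /choice[f fP] n : exists f, [/\ V f, dot f f = 1 & M - n.+1%:R^-1 < dot (kop f) f].
  have n0 : 0 < n.+1%:R^-1 :> R by rewrite invr_gt0.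
  by have [_ [f [Vf f1] <-] fM] := sup_adherent n0 supM; exists f.
have Vf n : V (f n) by have [] := fP n.
have bf n : bmeas (f n) by have [] := Vf n.
have f1 n : dot (f n) (f n) = 1 by have [] := fP n.
have kf1 n x : `|kop (f n) x| <= 1.
  rewrite -(@ler_pXn2r _ 2)// ?nnegrE// real_normK ?num_real// expr1n -(f1 n).
  exact: integral_op_le.
have [phi [phi_ge [p phiP]]] := diag_subseq (fun n i => kf1 n (q i)).
pose F n := f (phi n).
have bF n : bmeas (F n) := bf _.
have bkF n : bmeas (kop (F n)) := bmeas_integral_op (bF n).
have cF x : cvgn (fun n => kop (F n) x).
  by apply: pointwise_cvg => [n|n|i]; [exact: bf|exact: f1|apply: cvgP (phiP i)].
pose G x := limn (fun n => kop (F n) x).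
have [bG _] : bmeas G /\ mean P (kop (F n)) @[n --> \oo] --> mean P G.
  by apply: (@mean_cvg _ _ _ P _ _ 1) => [n|n x|x]; [exact: bkF|exact: kf1|exact: cF].
(* Here e = r + s: [r] vanishes in L^2 by [residual_le], and [s] by dominated convergence. So M F_n
   tends to G in L^2, and G is the eigenfunction up to scaling. *)
pose r n x := M * F n x - kop (F n) x.
pose s n x := kop (F n) x - G x.
pose e n x := M * F n x - G x.
have br n : bmeas (r n) by have := bF n; have := bkF n; rewrite /r; bmeas.
have bs n : bmeas (s n) by have := bkF n; rewrite /s; bmeas.
have be n : bmeas (e n) by have := bF n; rewrite /e; bmeas.
have r0 : dot (r n) (r n) @[n --> \oo] --> 0.
  have lim0 : (M + 1) * n.+1%:R^-1 @[n --> \oo] --> (0 : R).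
    by rewrite -(mulr0 (M + 1)); apply: cvgMr; exact: cvg_harmonic.
  apply: squeeze_cvgr (cvg_cst 0) lim0; apply: nearW => n.
  rewrite dot_ge0 (le_trans (residual_le (Vf _) (f1 _) M0))//.
  rewrite ler_wpM2l ?addr_ge0 ?(ltW M0)//.
  have [_ _ /ltW fM] := fP (phi n).
  rewrite lerBlDr -lerBlDl (le_trans _ fM)// lerB// lef_pV2 ?posrE// ler_nat ltnS.
  exact: phi_ge.
have s0 : dot (s n) (s n) @[n --> \oo] --> 0.
  have [_ [C GC]] := bG.
  have [|n x|x|_] := @mean_cvg _ _ _ P (fun n x => s n x * s n x) (fun=> 0) ((1 + C) * (1 + C)).
  - by move=> n; have := bs n; bmeas.
  - by rewrite normrM ler_pM// (le_trans (ler_normB _ _))// lerD// kf1.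
  - have sx : s n x @[n --> \oo] --> 0.
      by rewrite -(subrr (G x)); apply: cvgB (cF x) (cvg_cst _).
    by rewrite -(mulr0 0); exact: cvgM.
  - by rewrite mean_cst.
have e0 : dot (e n) (e n) @[n --> \oo] --> 0.
  have lim0 : 2 * (dot (r n) (r n) + dot (s n) (s n)) @[n --> \oo] --> (0 : R).
    have -> : (0 : R) = 2 * (0 + 0) by ring.
    by apply: cvgMr; exact: cvgD.
  apply: squeeze_cvgr (cvg_cst 0) lim0; apply: nearW => n.
  rewrite dot_ge0 /=; have -> : e n = (fun x => r n x + s n x).
    by apply/funext => x; rewrite /e /r /s; ring.
  exact: dotD_le.
(* The image of [e n] at x tends to 0 by [integral_op_le], and also to M G x - kop G x. The equation
   therefore holds at every x. *)
have eigG x : kop G x = M * G x.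
  have ke n : kop (e n) x = M * kop (F n) x - kop G x.
    by have := bF n => bFn; rewrite integral_opB ?integral_opZ//; bmeas.
  have lim0 : kop (e n) x ^+ 2 @[n --> \oo] --> (M * G x - kop G x) ^+ 2.
    under eq_fun do rewrite ke.
    by rewrite expr2; apply: cvgM; apply: cvgB (cvg_cst _); apply: cvgMr; exact: cF.
  have lim0' : kop (e n) x ^+ 2 @[n --> \oo] --> 0.
    by apply: squeeze_cvgr (cvg_cst 0) e0; apply: nearW => n; rewrite sqr_ge0 integral_op_le.
  have : (M * G x - kop G x) ^+ 2 = 0 :> R by exact: (cvg_unique _ lim0 lim0').
  by move=> /eqP; rewrite sqrf_eq0 subr_eq0 => /eqP ->.
have Gg i : dot G (g i) = 0.
  apply/eqP; rewrite -sqrf_eq0 eq_le sqr_ge0 andbT.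
  apply: (le0_of_cvg0 (c := dot (g i) (g i)) e0) => n.
  rewrite mulrC (le_trans _ (cauchy_schwarz P (be n) (bg i)))//.
  have [bFn Fg] := Vf (phi n).
  by rewrite dotBl ?dotZl//; [rewrite Fg mulr0 sub0r sqrrN|bmeas].
(* The limit does not degenerate: M F_n = e_n + G has squared norm M^2, hence M^2 <= 2 (|e_n|^2 +
   |G|^2), and e_n tends to 0. *)
have GG0 : 0 < dot G G.
  have : M ^+ 2 - 2 * dot G G <= 0.
    apply: (le0_of_cvg0 (c := 2) e0) => n.
    have := dotD_le P (be n) bG.
    have -> : (fun x => e n x + G x) = (fun x => M * F n x).
      by apply/funext => x; rewrite /e subrK.
    have bFn := bF n.
    rewrite dotZl ?dotZr//; last bmeas.
    by rewrite f1 mulr1 expr2; lra.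
  by have := exprn_gt0 2 M0; lra.
pose c := (Num.sqrt (dot G G))^-1.
exists (fun x => c * G x), M; split=> //.
- bmeas.
- rewrite dotZl ?dotZr//; last bmeas.
  by rewrite mulrA -expr2 exprVn sqr_sqrtr ?dot_ge0// mulVf// gt_eqF.
- by move=> i; rewrite dotZl// Gg mulr0.
- by move=> x; rewrite integral_opZ// eigG; ring.
Qed.

End MaxEigen.
End Operator.

Lemma seq_pos_lb {R : realType} (s : seq R) :
  exists2 e : R, 0 < e & forall x, x \in s -> 0 < x -> e <= x.
Proof.
elim: s => [|y s [e e0 es]]; first by exists 1.
exists (if 0 < y then Num.min e y else e).
  by case: ifPn => // y0; rewrite lt_min e0.
move=> x; rewrite inE => /orP[/eqP-> y0|xs x0]; first by rewrite y0 ge_min lexx orbT.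
by case: ifPn => _; rewrite ?ge_min es.
Qed.

(** * Infinitely many positive eigenvalues *)

Section InfinitelyMany.
Context {d : measure_display} {T : measurableType d} {R : realType}.
Variable P : probability T R.
Implicit Types f g h : T -> R.
Local Notation dot := (inner P).
Variable k : T -> T -> R.
Local Notation kop := (integral_op P k).
Hypothesis mk : measurable_fun setT (fun z : T * T => k z.1 z.2).
Hypothesis ksym : forall x y, k x y = k y x.
Hypothesis k_le1 : forall x y, `|k x y| <= 1.

Definition orthonormal_eigenfamily N (g : 'I_N -> T -> R) (mu : 'I_N -> R) :=
  [/\ forall i, bmeas (g i), forall i j, dot (g i) (g j) = (i == j)%:R,
      forall i, 0 < mu i & forall i x, kop (g i) x = mu i * g i x].

(** The Fourier coefficients of the section [k x] along the [g i] are the numbers mu_i g_i(x).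
    Bessel's inequality for this section, of norm at most 1, is then integrated over x. *)
Lemma bessel N (g : 'I_N -> T -> R) mu : orthonormal_eigenfamily g mu ->
  \sum_i mu i ^+ 2 <= 1.
Proof.
move=> [bg og _ eg].
have pointwise x : \sum_i mu i ^+ 2 * (g i x * g i x) <= 1.
  (* The orthogonal projection of [k x] onto the span of the [g i]. *)
  pose s y := \sum_i (mu i * g i x) * g i y.
  have bs : bmeas s by rewrite /s; bmeas.
  have bkx : bmeas (k x) := bmeas_k mk k_le1 x.
  have dks f : bmeas f -> dot s f = \sum_i (mu i * g i x) * dot (g i) f.
    move=> bf; rewrite /s dot_suml//; last by move=> i; bmeas.
    by apply: eq_bigr => i _; rewrite dotZl.
  have skE : dot s (k x) = \sum_i mu i ^+ 2 * (g i x * g i x).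
    rewrite dks//; apply: eq_bigr => i _.
    by rewrite dotC -/(integral_op P k (g i) x) eg expr2 mulrACA.
  have ssE : dot s s = \sum_i mu i ^+ 2 * (g i x * g i x).
    rewrite dks//; apply: eq_bigr => i _; rewrite dotC dks// (bigD1 i)//= og eqxx.
    rewrite big1 => [|j /negbTE ji]; last by rewrite og ji mulr0.
    by rewrite mulr1 addr0 expr2 mulrACA.
  have := dot_ge0 P (fun y => k x y - s y).
  rewrite !dotBl; [|bmeas..]; rewrite !dotBr; [|bmeas..].
  rewrite (dotC P (k x) s) skE ssE; have := dot_k_le1 P mk k_le1 x.
  set S := \sum_i _; lra.
have b2 i : bmeas (fun x => mu i ^+ 2 * (g i x * g i x)) by have := bg i; bmeas.
have -> : \sum_i mu i ^+ 2 = mean P (fun x => \sum_i mu i ^+ 2 * (g i x * g i x)).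
  rewrite mean_sum//; apply: eq_bigr => i _; rewrite meanZ; last by have := bg i; bmeas.
  by rewrite -/(dot (g i) (g i)) og eqxx mulr1.
rewrite -[leRHS](mean_cst P); apply: ler_mean => //; bmeas.
Qed.

Variable q : nat -> T.
Hypothesis qdense : forall x e, 0 < e ->
  exists i, dot (fun y => k x y - k (q i) y) (fun y => k x y - k (q i) y) < e.
Variables (w : nat -> T -> R) (h : T -> R) (s : R) (D : nat -> R).
Hypotheses (bw : forall i, bmeas (w i)) (bh : bmeas h) (D_gt0 : forall i, 0 < D i).
Hypothesis formw : forall i j,
  dot (kop (w i)) (w j) = D i *+ (i == j) + s * dot (w i) h * dot (w j) h.

(* [N + 2] functions against [N + 1] linear conditions: being orthogonal to the
   [g i], and to [h], which kills the rank one term of [formw]. *)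
Lemma positive_orthogonal N (g : 'I_N -> T -> R) : (forall i, bmeas (g i)) ->
  exists f, (bmeas f /\ forall i, dot f (g i) = 0) /\ 0 < dot (kop f) f.
Proof.
move=> bg.
pose G (i : 'I_N.+1) := if unlift ord0 i is Some j then g j else h.
have bG i : bmeas (G i) by rewrite /G; case: unlift.
pose A := \matrix_(j < N.+2, i < N.+1) dot (w j) (G i).
have /negP kerA : ~~ (kermx A == 0).
  by rewrite -mxrank_eq0 mxrank_ker subn_eq0 -ltnNge ltnS rank_leq_col.
pose c := nz_row (kermx A).
have c0 : c != 0 by rewrite nz_row_eq0; apply/negP.
have cA : c *m A = 0 by apply/sub_kermxP; exact: nz_row_sub.
pose f x := \sum_j c 0 j * w j x.
have bf : bmeas f by rewrite /f; bmeas.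
have fE f' : bmeas f' -> dot f f' = \sum_j c 0 j * dot (w j) f'.
  move=> bf'; rewrite /f dot_suml//; last by move=> i; bmeas.
  by apply: eq_bigr => i _; rewrite dotZl.
have fG i : dot f (G i) = 0.
  rewrite fE//; transitivity ((c *m A) 0 i); last by rewrite cA mxE.
  by rewrite mxE; apply: eq_bigr => j _; rewrite mxE.
have fh : \sum_j c 0 j * dot (w j) h = 0.
  by rewrite -fE//; have := fG ord0; rewrite /G unlift_none.
exists f; split; first split=> // i.
  by have := fG (lift ord0 i); rewrite /G liftK.
have bkf := bmeas_integral_op P mk k_le1 bf.
(* The factor 0 stands for the inner product of f and h, written as in [fh]; only the diagonal part
   of [formw] survives. *)
have kw (j : 'I_N.+2) : dot (w j) (kop f) = c 0 j * D j + s * dot (w j) h * 0.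
  have bkw i := bmeas_integral_op P mk k_le1 (bw i).
  rewrite -(integral_op_sym P mk) // dotC (fE _ (bkw j)).
  transitivity (\sum_(i < N.+2) ((c 0 i * D i) *+ (i == j) +
    s * dot (w j) h * (c 0 i * dot (w i) h))).
    apply: eq_bigr => i _; rewrite dotC formw.
    rewrite -[i == j]val_eqE/= (eq_sym (val i)).
    by case: eqP => [->|_]; rewrite ?mulr1n ?mulr0n; ring.
  rewrite big_split/= -mulr_sumr fh; congr (_ + _).
  rewrite (bigD1 j)//= eqxx big1 ?addr0// => i /negbTE ->.
  by [].
rewrite dotC fE//.
under eq_bigr do rewrite kw mulr0 addr0 mulrA -expr2.
have [j cj] : exists j, c 0 j != 0.
  apply/existsP; rewrite -negb_forall; apply: contra c0 => /forallP cj0.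
  by apply/eqP/rowP => j; rewrite mxE; apply/eqP.
rewrite (bigD1 j)//= ltr_pwDl//.
  by rewrite mulr_gt0// exprn_even_gt0.
by apply: sumr_ge0 => i _; rewrite mulr_ge0 ?sqr_ge0// ltW.
Qed.

Lemma exists_eigenfamily N :
  exists (g : 'I_N -> T -> R) mu, orthonormal_eigenfamily g mu.
Proof.
elim: N => [|N [g [mu [bg og mu0 eg]]]].
  by exists (fun _ _ => 0), (fun=> 1); split=> -[].
have [f [nu [bf ff fg nu0 ef]]] :=
  max_eigen mk ksym k_le1 bg eg qdense (positive_orthogonal bg).
exists (fun i => if unlift ord0 i is Some j then g j else f).
exists (fun i => if unlift ord0 i is Some j then mu j else nu).
split=> [i|i j|i|i x]; try by case: unlift => [?|].
case: (unliftP ord0 i) => [i' ->|->]; case: (unliftP ord0 j) => [j' ->|->]//.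
by rewrite dotC fg.
Qed.

Lemma infinitely_many_eigenvalues :
  infinite_set [set nu | 0 < nu /\
    exists f, [/\ bmeas f, dot f f = 1 & forall x, kop f x = nu * f x]].
Proof.
move=> /finite_seqP[r rE]; have [e e0 er] := seq_pos_lb r.
(* If only finitely many values occurred, all would be at least some e > 0, and N > e^-2 of them,
   counted with multiplicity, would have squares summing to more than 1. The [mu i] may repeat. *)
pose N := (Num.truncn (e ^- 2)).+1.
have [g [mu gmu]] := exists_eigenfamily N; have [bg og mu0 eg] := gmu.
have emu i : e <= mu i.
  apply: er => //; suff : [set` r] (mu i) by [].
  by rewrite -rE; split=> //; exists (g i); split=> //; rewrite og eqxx.
have : \sum_(i < N) e ^+ 2 <= 1.
  apply: le_trans (bessel gmu); apply: ler_sum => i _.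
  by rewrite lerXn2r ?nnegrE ?(ltW e0)// ltW.
rewrite sumr_const card_ord -mulr_natl -ler_pdivlMr ?exprn_gt0// mul1r leNgt.
by rewrite truncnS_gt.
Qed.

End InfinitelyMany.

(** * The kernel, and the completed Lebesgue measure *)

(** The inverse is the pointwise limit of the continuous functions x / (x^2 + 1/(n+1)), also at 0,
    where both they and the inverse take the value 0. *)
Lemma measurable_inv {R : realType} : measurable_fun setT (@GRing.inv R).
Proof.
pose h n (x : R) := x / (x ^+ 2 + n.+1%:R^-1).
have pos n (x : R) : 0 < x ^+ 2 + n.+1%:R^-1 by rewrite ltr_wpDl ?sqr_ge0// invr_gt0.
apply: (measurable_fun_cvg (h := h)) => [n|x _].
  apply: continuous_measurable_fun => x; apply: cvgM; first exact: cvg_id.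
  apply: cvgV; first by rewrite gt_eqF.
  by apply: cvgD; [exact: exprn_continuous|exact: cvg_cst].
have [->|x0] := eqVneq x 0.
  by rewrite invr0 /h; under eq_fun do rewrite mul0r; exact: cvg_cst.
have -> : x^-1 = x / (x ^+ 2 + 0) by rewrite addr0 expr2 invfM mulVKf.
apply: cvgM; first exact: cvg_cst.
apply: cvgV; first by rewrite addr0 sqrf_eq0.
by apply: cvgD; [exact: cvg_cst|exact: cvg_harmonic].
Qed.

Lemma floor_cvg {R : realType} (u : nat -> R) (t : R) :
  u n @[n --> \oo] --> t -> t != (Num.floor t)%:~R ->
  (Num.floor (u n))%:~R @[n --> \oo] --> ((Num.floor t)%:~R : R).
Proof.
move=> ut tn; have /andP[ft tf] := floor_itv t.
have {}ft : (Num.floor t)%:~R < t by rewrite lt_neqAle eq_sym tn.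
apply: cvg_near_cst.
have near_gt : \forall n \near \oo, (Num.floor t)%:~R < u n by exact: cvgr_gt ut _ ft.
have near_lt : \forall n \near \oo, u n < (Num.floor t + 1)%:~R by exact: cvgr_lt ut _ tf.
apply: filterS2 near_gt near_lt => n gt_n lt_n.
by rewrite (floor_def (m := Num.floor t))// (ltW gt_n).
Qed.

Section Kernel.
Context {R : realType}.
Notation K := (@kernel_frac R).
(** Lebesgue measure of [0, 1] carried by the whole line: integrals need no domain, and the total
    mass is 1. *)
Definition uniform01 : probability (measurableTypeR R) R := uniform_prob (@ltr01 R).
Local Notation P := uniform01.

(** A form without case distinction, suited to measurability and limits: at xy = 0 the inverse and
    its floor are 0, and the indicator cancels the remaining 1/2. *)
Lemma kernel_fracE (x y : R) : K x y = 1 / 2 - 1 / 2 * (x * y == 0)%:R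
  - (x * y)^-1 + (Num.floor (x * y)^-1)%:~R.
Proof.
rewrite /kernel_frac /fracpart; case: eqP => [->|_] /=.
  by rewrite invr0 floor0 mulr1 subrr subr0 addr0.
by rewrite !div1r mulr0 subr0 opprB addrA addrAC.
Qed.

Lemma measurable_kernel_frac : measurable_fun setT (fun z : R * R => K z.1 z.2).
Proof.
have mM : measurable_fun setT (fun z : R * R => z.1 * z.2).
  by apply: measurable_funM; [exact: measurable_fst|exact: measurable_snd].
have mV : measurable_fun setT (fun z : R * R => (z.1 * z.2)^-1).
  exact: (measurableT_comp measurable_inv mM).
under eq_fun do rewrite kernel_fracE.
apply: measurable_funD.
  apply: measurable_funB => //; apply: measurable_funB => //.
  apply: measurable_funM => //.
  have -> : (fun z : R * R => (z.1 * z.2 == 0)%:R : R) =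
      (fun z => if z.1 * z.2 == 0 then 1 else 0).
    by apply/funext => z; case: eqP.
  by apply: measurable_fun_ifT => //; exact: measurable_fun_eqr.
have mfl : measurable_fun setT (fun t : R => (Num.floor t)%:~R : R).
  by apply: nondecreasing_measurable => // x y xy; rewrite ler_int le_floor.
exact: (measurableT_comp mfl mV).
Qed.

Lemma kernel_frac_sym (x y : R) : K x y = K y x.
Proof. by rewrite /kernel_frac mulrC. Qed.

Lemma kernel_frac_le1 (x y : R) : `|K x y| <= 1.
Proof.
rewrite /kernel_frac /fracpart; case: eqP => _; first by rewrite normr0.
have /andP[] := floor_itv (1 / (x * y)); rewrite intrD => ? ?.
by rewrite ler_norml; apply/andP; split; lra.
Qed.

Lemma bmeas_kernel x : bmeas (K x).
Proof. exact: (bmeas_k measurable_kernel_frac kernel_frac_le1 x). Qed.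

Lemma ae_unif_countable (A : set R) (B : R -> Prop) : countable A ->
  (forall y, ~ A y -> B y) -> {ae P, forall y, B y}.
Proof.
move=> cA AB.
have mA : measurable (A : set (measurableTypeR R)) by exact: countable_measurable.
exists A; split=> //; last by move=> y /= By; apply: contrapT => /AB.
have /null_content_dominatesP dom := dominates_uniform_prob (@ltr01 R).
by apply: dom => //; exact: countable_lebesgue_measure0.
Qed.

(* The exceptional [y] are those where [1 / (x * y)] is an integer. *)
Lemma kernel_frac_cvg (z : nat -> R) x : z n @[n --> \oo] --> x -> x != 0 ->
  exists2 A : set R, countable A &
    forall y, ~ A y -> K (z n) y @[n --> \oo] --> K x y.
Proof.
move=> zx x0.
(* The index m = 0 contributes the point 0, since the inverse of 0 is 0; so y = 0 is excluded as
   well. *)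
pose A := (fun m : int => (x * m%:~R)^-1) @` setT.
have cA : countable A by apply: sub_countable (card_image_le _ _) (countableP _).
exists A => // y Ay.
have y0 : y != 0.
  by apply/eqP => y0; apply: Ay; exists 0 => //; rewrite mulr0 invr0.
have xy0 : x * y != 0 by rewrite mulf_neq0.
have zxy : z n * y @[n --> \oo] --> x * y by apply: cvgMl.
have zn0 : \forall n \near \oo, z n * y != 0 by exact: cvgr_neq0 zxy xy0.
have zV : (z n * y)^-1 @[n --> \oo] --> (x * y)^-1 by apply: cvgV.
have fl : (x * y)^-1 != (Num.floor (x * y)^-1)%:~R.
  apply/eqP => fxy; apply: Ay; exists (Num.floor (x * y)^-1) => //.
  by rewrite -fxy invfM invrK mulKf.
rewrite kernel_fracE (negbTE xy0).
under eq_fun do rewrite kernel_fracE.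
apply: cvgD (floor_cvg zV fl); apply: cvgB zV; apply: cvgB; first exact: cvg_cst.
apply: cvgMr; apply: cvg_near_cst.
by apply: filterS zn0 => n /negbTE ->.
Qed.

Definition rat_enum n : R := if unpickle n is Some r then ratr r else 0.

Lemma kernel_frac_dense x e : 0 < e ->
  exists i, inner P (fun y => K x y - K (rat_enum i) y) (fun y => K x y - K (rat_enum i) y) < e.
Proof.
(* [kernel_frac_cvg] says nothing at x = 0, but 0 is itself one of the enumerated points. Elsewhere,
   rationals tending to x and dominated convergence suffice. *)
move=> e0; have [->|x0] := eqVneq x 0.
  exists (pickle (0 : rat)); rewrite /rat_enum pickleK raddf0 /inner.
  under eq_fun do rewrite subrr mulr0.
  by rewrite mean_cst.
have /choice[r rP] n : exists r : rat, `|x - ratr r| < n.+1%:R^-1.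
  have : x - n.+1%:R^-1 < x + n.+1%:R^-1 by rewrite ltrD2l gtrN// invr_gt0.
  by move=> /rat_in_itvoo[r]; rewrite in_itv/= -ltr_distl distrC => ?; exists r.
pose z n : R := ratr (r n).
have zx : z n @[n --> \oo] --> x.
  apply/cvgrPdist_lt => d d0.
  apply: filterS (near_infty_natSinv_lt (PosNum d0)) => n /=.
  exact: lt_trans (rP n).
pose f n y := (K x y - K (z n) y) * (K x y - K (z n) y).
have bf n : bmeas (f n).
  by have := bmeas_kernel x; have := bmeas_kernel (z n); rewrite /f => ? ?; bmeas.
have f0 : mean P (f n) @[n --> \oo] --> mean P (fun=> 0).
  apply: (@mean_cvg_ae _ _ _ P f (fun=> 0) (2 * 2)) => //.
  - exact: bmeas_cst.
  - by move=> n y; rewrite normrM ler_pM// (le_trans (ler_normB _ _))//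
      -[leRHS]/(1 + 1 : R) lerD// kernel_frac_le1.
  - have [A cA AK] := kernel_frac_cvg zx x0.
    apply: (ae_unif_countable cA) => y /AK Ky.
    rewrite -(mulr0 0) -(subrr (K x y)).
    by apply: cvgM; apply: cvgB Ky; exact: cvg_cst.
have [n /= fn] : exists n, mean P (f n) < e.
  rewrite mean_cst in f0.
  have : \forall n \near \oo, mean P (f n) < e by exact: cvgr_lt f0 _ e0.
  by move=> [n _ /(_ n (leqnn n))]; exists n.
by exists (pickle (r n)); rewrite /rat_enum pickleK.
Qed.

End Kernel.

(** * Passage to the completed Lebesgue measure *)

Section Transfer.
Context {R : realType}.
Local Notation P := (@uniform01 R).
Local Notation mu := (@completed_lebesgue_measure R).

Lemma measurable_lebesgueTypeR (D : set R) (f : R -> R) : measurable D ->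
  measurable_fun setT f -> measurable_fun (D : set (lebesgueTypeR R)) f.
Proof.
move=> mD mf _ Y mY.
have mDY : measurable (D `&` f @^-1` Y).
  by apply: (measurableI _ _ mD); rewrite -[X in measurable X]setTI; exact: mf.
exact: (@sub_caratheodory _ _ _ (wlength (@idfun R))) mDY.
Qed.

(** The identity as a map from the completed sigma-algebra to the Borel one. Lebesgue measure is the
    pushforward of its completion along it, so integrals of Borel functions agree by change of
    variables. *)
Let id_lebesgue : lebesgueTypeR R -> measurableTypeR R := id.

Let measurable_id_lebesgue : measurable_fun setT id_lebesgue.
Proof. by move=> _ Y mY; rewrite setTI; exact: sub_caratheodory. Qed.

Lemma ge0_integral_completed (f : R -> \bar R) : measurable_fun setT f ->
  (forall x, (0 <= f x)%E) ->
  (\int[mu]_(x in `[0%R, 1%R]) f x = \int[P]_x f x)%E.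
Proof.
move=> mf f0; rewrite /uniform01 integral_uniform// subr0 invr1 mul1e.
rewrite (eq_measure_integral (pushforward mu id_lebesgue))//.
rewrite ge0_integral_pushforward//.
exact: measurable_funTS.
Qed.

Lemma integral_completed (f : R -> R) : bmeas f ->
  Rintegral mu `[0, 1]%classic f = mean P f.
Proof.
move=> [mf _]; rewrite /mean /Rintegral; congr fine.
have mEf : measurable_fun setT (EFin \o f) by exact/measurable_EFinP.
rewrite integralE [RHS]integralE; congr (_ - _)%E.
  by apply: ge0_integral_completed => //; exact: measurable_funepos.
by apply: ge0_integral_completed => //; exact: measurable_funeneg.
Qed.

(* [nu] is an eigenvalue of the operator, hence its inverse in the convention of
   [eigenvalue_of]. *)
Lemma eigenvalue_transfer (s nu : R) (f : R -> R) : s != 0 -> nu != 0 -> bmeas f ->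
  inner P f f = 1 -> (forall x, integral_op P (fun x y => s * kernel_frac x y) f x = nu * f x) ->
  eigenvalue_of (@kernel_frac R) (s / nu)%:C%C.
Proof.
move=> s0 nu0 bf f1 ef; split.
  by rewrite -[0]/(0%:C)%C (inj_eq (@complexI R)) mulf_neq0 ?invr_neq0.
have [mf _] := bf.
have bK x := bmeas_kernel (R := R) x.
have normE : (\int[mu]_(x in `[0%R, 1%R]) (Normc.normc ((f x)%:C)%C ^+ 2)%:E = 1)%E.
  have normf x : Normc.normc ((f x)%:C)%C ^+ 2 = f x * f x.
    by rewrite /= expr0n addr0 sqr_sqrtr ?sqr_ge0// expr2.
  under eq_integral do rewrite normf.
  rewrite ge0_integral_completed//.
  - by rewrite mean_EFin; [rewrite -/(inner P f f) f1|bmeas].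
  - by apply/measurable_EFinP; exact: measurable_funM.
  - by move=> x; rewrite lee_fin -expr2 sqr_ge0.
exists (fun x => (f x)%:C)%C; split.
- split; first exact: measurable_lebesgueTypeR.
  by apply: measurable_lebesgueTypeR => //; exact: measurable_cst.
- by rewrite normE lte01.
- by rewrite normE ltry.
apply: aeW => x _.
have -> : cintegral01 (fun y => (kernel_frac x y)%:C * (f y)%:C)%C
    = ((nu / s * f x)%:C)%C.
  rewrite /cintegral01; congr (_ +i* _)%C.
    rewrite (_ : _ \o _ = (fun y => kernel_frac x y * f y)); last first.
      by apply/funext => y; rewrite /= !mul0r subr0.
    rewrite integral_completed; last by have := bK x; bmeas.
    apply: (mulfI s0); rewrite mulrA mulrCA mulfV// mulr1 -ef /integral_op dotZl//.
    exact: bK.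
  rewrite (_ : _ \o _ = (fun y => 0)); last first.
    by apply/funext => y; rewrite /= mulr0 mul0r addr0.
  by rewrite integral_completed ?mean_cst//; exact: bmeas_cst.
rewrite -rmorphM; congr (_%:C)%C.
by rewrite mulrA [X in X * _]mulrA divfK// mulfV// mul1r.
Qed.

End Transfer.

(** * Positive and negative directions of the kernel *)

Section StepFunctions.
Context {R : realType}.
Local Notation P := (@uniform01 R).
Implicit Types a b c x y z : R.

Lemma bmeas_itv (i : interval R) : bmeas (fun y => (y \in i)%:R : R).
Proof.
split; last by exists 1 => y; case: (y \in i); rewrite ?normr1 ?normr0.
have -> : (fun y => (y \in i)%:R : R) = \1_[set` i].
  by apply/funext => y; rewrite indicE mem_setE.
exact: measurable_indic.
Qed.

Lemma mean_itv (i : interval R) : [set` i] `<=` `[0, 1] ->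
  mean P (fun y => (y \in i)%:R) = fine (lebesgue_measure [set` i]).
Proof.
move=> i01; rewrite /mean /Rintegral /uniform01 integral_uniform.
- rewrite subr0 invr1 mul1e.
  have -> : (fun y : R => ((y \in i)%:R : R)%:E) = (fun y => (\1_[set` i] y)%:E).
    by apply/funext => y; rewrite indicE mem_setE.
  by rewrite integral_indic// setIidl.
- by apply/measurable_EFinP; case: (bmeas_itv i).
- by move=> y; rewrite lee_fin ler0n.
Qed.

Lemma mean_itvco a b : 0 <= a -> a <= b -> b <= 1 ->
  mean P (fun y => (y \in `[a, b[)%:R) = b - a.
Proof.
move=> a0 ab b1; rewrite mean_itv.
  rewrite lebesgue_measure_itv/= lte_fin; case: ltP => //= ba.
  by apply/esym/eqP; rewrite subr_eq0 eq_le ab ba.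
move=> y /=; rewrite !in_itv/= => /andP[ay yb].
by rewrite (le_trans a0 ay) ltW// (lt_le_trans yb).
Qed.

Lemma mean_itvcc a b : 0 <= a -> a <= b -> b <= 1 ->
  mean P (fun y => (y \in `[a, b])%:R) = b - a.
Proof.
move=> a0 ab b1; rewrite mean_itv.
  rewrite lebesgue_measure_itv/= lte_fin; case: ltP => //= ba.
  by apply/esym/eqP; rewrite subr_eq0 eq_le ab ba.
move=> y /=; rewrite !in_itv/= => /andP[ay yb].
by rewrite (le_trans a0 ay) (le_trans yb).
Qed.

Lemma mean_gt0 (f : R -> R) a b : bmeas f -> (forall y, 0 <= f y) ->
  0 <= a -> a < b -> b <= 1 -> (forall y, a <= y < b -> 0 < f y) -> 0 < mean P f.
Proof.
move=> bf f0 a0 ab b1 fpos; rewrite lt_neqAle mean_ge0// andbT.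
apply/eqP => mf0; have [mf _] := bf.
have mEf : measurable_fun setT (EFin \o f) by exact/measurable_EFinP.
have [+ _] := ae_eq_integral_abs P measurableT mEf.
have -> : (\int[P]_y `|(EFin \o f) y| = 0)%E.
  transitivity (\int[P]_y (f y)%:E)%E; last by rewrite mean_EFin// -mf0.
  by apply: eq_integral => y _; rewrite /= ger0_norm.
move=> /(_ erefl) [N [mN N0 subN]].
have abN : mean P (fun y => (y \in `[a, b[)%:R) <= mean P \1_N.
  apply: ler_mean; first exact: bmeas_itv.
    split; first exact: measurable_indic.
    by exists 1 => y; rewrite indicE; case: (_ \in _); rewrite ?normr1 ?normr0.
  move=> y; case: (boolP (y \in `[a, b[)) => [|_]; last by rewrite indicE ler0n.
  rewrite in_itv/= => /fpos fy; rewrite indicE mem_set//.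
  by apply: subN => /= /(_ Logic.I) [fy0]; rewrite fy0 ltxx in fy.
move: abN; rewrite mean_itvco// ?(ltW ab)// /mean /Rintegral integral_indic// setIT N0/=.
by rewrite leNgt subr_gt0 ab.
Qed.

Definition step a b c y : R :=
  (y \in `[a, b[)%:R / (b - a) - (y \in `[b, c[)%:R / (c - b).

(** The primitive of f. For [step a b c] inside [0, 1] it is a tent: zero outside [a, c], with peak
    1 at b. *)
Definition cumul z (f : R -> R) : R := mean P (fun y => (y \in `]-oo, z])%:R * f y).

Lemma bmeas_step a b c : bmeas (step a b c).
Proof. by have := @bmeas_itv; rewrite /step => H; bmeas. Qed.

Lemma step_left a b c y : a <= y < b -> step a b c y = (b - a)^-1.
Proof.
move=> /andP[ay yb]; rewrite /step !in_itv/= ay yb (leNgt b) yb/=.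
by rewrite mul1r mul0r subr0.
Qed.

Lemma step_right a b c y : b <= y < c -> step a b c y = - (c - b)^-1.
Proof.
move=> /andP[bey yc]; rewrite /step !in_itv/= bey yc (ltNge y b) bey/= andbF.
by rewrite mul1r mul0r sub0r.
Qed.

Lemma step_lt a b c y : a < b -> y < a -> step a b c y = 0.
Proof.
move=> ab ya; rewrite /step !in_itv/= !leNgt ya (lt_trans ya ab)/=.
by rewrite !mul0r subr0.
Qed.

Lemma step_ge a b c y : b < c -> c <= y -> step a b c y = 0.
Proof.
move=> bc cy; rewrite /step !in_itv/= !ltNge cy (le_trans (ltW bc) cy)/= !andbF.
by rewrite !mul0r subr0.
Qed.

Section OneStep.
Variables a b c : R.
Hypotheses (a0 : 0 <= a) (ab : a < b) (bc : b < c) (c1 : c <= 1).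

Let cb0 : c - b != 0. Proof. by rewrite subr_eq0 gt_eqF. Qed.
Let ba0 : b - a != 0. Proof. by rewrite subr_eq0 gt_eqF. Qed.
Let b0 : 0 <= b. Proof. exact: le_trans a0 (ltW ab). Qed.
Let b1 : b <= 1. Proof. exact: le_trans (ltW bc) c1. Qed.
Let leab : a <= b. Proof. exact: ltW. Qed.
Let lebc : b <= c. Proof. exact: ltW. Qed.

Lemma mean_step : mean P (step a b c) = 0.
Proof.
have bi := @bmeas_itv.
have -> : step a b c = (fun y => (b - a)^-1 * (y \in `[a, b[)%:R -
    (c - b)^-1 * (y \in `[b, c[)%:R).
  by apply/funext => y; rewrite /step mulrC (mulrC (c - b)^-1).
rewrite meanB; [|bmeas..]; rewrite !meanZ; [|exact: bi..].
rewrite !mean_itvco//.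
by rewrite !mulVf// subrr.
Qed.

Lemma cumul_lt z : z < a -> cumul z (step a b c) = 0.
Proof.
move=> za; rewrite /cumul -[RHS](mean_cst P); congr mean.
apply/funext => y; rewrite in_itv/=; case: leP => yz; last by rewrite mul0r.
by rewrite step_lt ?mulr0// (le_lt_trans yz).
Qed.

Lemma cumul_ge z : c <= z -> cumul z (step a b c) = 0.
Proof.
move=> cz; rewrite -mean_step /cumul; congr mean.
apply/funext => y; rewrite in_itv/=; case: leP => yz; first by rewrite mul1r.
by rewrite step_ge ?mulr0// (le_trans cz)// ltW.
Qed.

Lemma cumul_mid z : b <= z < c -> cumul z (step a b c) = 1 - (z - b) / (c - b).
Proof.
move=> /andP[bz zc]; have bi := @bmeas_itv.
have -> : cumul z (step a b c) = mean P (fun y => (b - a)^-1 * (y \in `[a, b[)%:R -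
    (c - b)^-1 * (y \in `[b, z])%:R).
  congr mean; apply/funext => y; rewrite /step !in_itv/=.
  case: (leP y z) => yz; rewrite ?(le_lt_trans yz zc)/= ?andbT ?andbF.
    by rewrite mul1r mulrC (mulrC (c - b)^-1).
  by rewrite (ltNge y b) (le_trans bz (ltW yz))/= andbF !mulr0 subr0 mul0r.
rewrite meanB; [|bmeas..]; rewrite !meanZ; [|exact: bi..].
rewrite mean_itvco// mean_itvcc//; last exact: le_trans (ltW zc) c1.
by rewrite mulVf// mulrC.
Qed.

End OneStep.
End StepFunctions.

(** * Blocks reflected about 1 / sqrt 2 *)

Section Blocks.
Context {R : realType}.
Local Notation P := (@uniform01 R).
Local Notation dot := (inner P).
Local Notation K := (@kernel_frac R).
Implicit Types x y z : R.

Definition dual x : R := (2 * x)^-1.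

(** This includes x = 0, which is fixed because the inverse of 0 is 0. *)
Lemma dualK x : dual (dual x) = x.
Proof. by rewrite /dual invfM invrK mulKf// pnatr_eq0. Qed.

Lemma ltr_dual x y : 0 < x -> x < y -> dual y < dual x.
Proof.
move=> x0 xy; rewrite /dual ltf_pV2 ?posrE ?mulr_gt0//; last exact: lt_trans xy.
by rewrite ltr_pM2l.
Qed.

Lemma ler_dual x y : 0 < x -> x <= y -> dual y <= dual x.
Proof.
by move=> x0; rewrite le_eqVlt => /predU1P[->//|xy]; rewrite ltW// ltr_dual.
Qed.

(** On this window 1/3 < xy < 1, so the floor of 1/(xy) is 1 or 2, and it is 2 exactly when xy <=
    1/2, that is when y <= [dual x]. *)
Lemma kernel_frac_near x y : 62 / 100 <= x <= 81 / 100 -> 62 / 100 <= y <= 81 / 100 ->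
  K x y = 3 / 2 - x^-1 * y^-1 + (y \in `]-oo, dual x])%:R.
Proof.
move=> /andP[x1 x2] /andP[y1 y2].
have x0 : 0 < x by lra.
have y0 : 0 < y by lra.
have xy0 : 0 < x * y by rewrite mulr_gt0.
rewrite kernel_fracE gt_eqF// mulr0 subr0 invfM.
set t := x^-1 * y^-1.
have txy : t * (x * y) = 1 by rewrite /t -invfM mulVf// gt_eqF.
have t0 : 0 < t by rewrite mulr_gt0// invr_gt0.
have xyl : 1 / 3 < x * y by nra.
have xyu : x * y < 1 by nra.
have t1 : 1 <= t by nra.
have t3 : t < 3 by nra.
have xdual : x * dual x = 1 / 2 by rewrite /dual invfM mulrCA mulfV ?gt_eqF//; lra.
rewrite in_itv/=; case: leP => yx /=.
  have xy2 : x * y <= 1 / 2 by rewrite -xdual ler_pM2l.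
  have t2 : 2 <= t by nra.
  rewrite (floor_def (m := 2)); first by lra.
  by apply/andP; split; [exact: t2|exact: t3].
have xy2 : 1 / 2 < x * y by rewrite -xdual ltr_pM2l.
have t2 : t < 2 by nra.
rewrite (floor_def (m := 1)); first by lra.
by apply/andP; split; [exact: t1|exact: t2].
Qed.

Variable p : nat -> R.
(** The points lie to the right of 1 / sqrt 2 and their reflections in [0.625, 0.7[, to the left of
    it; both stay within the window of [kernel_frac_near]. *)
Hypothesis p_bounds : forall i, 72 / 100 <= p i <= 80 / 100.
Hypothesis p_lt : forall i j, (i < j)%N -> p i < p j.

Let p_ge i : 72 / 100 <= p i. Proof. by case/andP: (p_bounds i). Qed.
Let p_le i : p i <= 80 / 100. Proof. by case/andP: (p_bounds i). Qed.
Let p_gt0 i : 0 < p i. Proof. by have := p_ge i; lra. Qed.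
Let q i := dual (p i).

Let dual_hi : dual (72 / 100) < 7 / 10 :> R.
Proof. by rewrite /dual -[ltLHS]mul1r ltr_pdivrMr; lra. Qed.
Let dual_lo : 625 / 1000 <= dual (80 / 100) :> R.
Proof. by rewrite /dual -[leRHS]mul1r ler_pdivlMr; lra. Qed.

Let q_lt i j : (i < j)%N -> q j < q i.
Proof. by move=> ij; rewrite ltr_dual// p_lt. Qed.
Let q_le_hi i : q i < 7 / 10.
Proof. by apply: le_lt_trans dual_hi; apply: ler_dual => //; lra. Qed.
Let q_ge_lo i : 625 / 1000 <= q i.
Proof. by apply: le_trans dual_lo _; apply: ler_dual. Qed.

(* Blocks use four consecutive points so that their closures are disjoint: the
   primitive of one block then vanishes on the reflection of any other. *)
Let right_step k := step (p (4 * k)) (p (4 * k).+1) (p (4 * k).+2).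
Let left_step k := step (q (4 * k).+3) (q (4 * k).+2) (q (4 * k).+1).

Variable s : R.
Hypothesis s2 : s * s = 1.

(** Reflection exchanges the two sides, so only products of a right and a left step survive in the
    form. In them the coefficient - s meets the factor s of the kernel, and s^2 = 1 makes their sign
    independent of s. *)
Definition block k y : R := right_step k y - s * left_step k y.

Let b_right k : bmeas (right_step k) := bmeas_step _ _ _.
Let b_left k : bmeas (left_step k) := bmeas_step _ _ _.

Lemma bmeas_block k : bmeas (block k).
Proof. by have := b_right k; have := b_left k; rewrite /block => ? ?; bmeas. Qed.

Let support_block k x : ~~ (62 / 100 <= x <= 81 / 100) -> block k x = 0.
Proof.
move=> xD; have : x < 625 / 1000 \/ 80 / 100 <= x.
  have [x1|x1] := ltP x (625 / 1000); [by left|right].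
  have [//|x2] := leP (80 / 100) x.
  by move: xD; rewrite negb_and -!ltNge => /orP[|]; lra.
rewrite /block /right_step /left_step => -[xlo|xhi].
  rewrite step_lt ?p_lt// ?step_lt ?q_lt// ?mulr0 ?subr0//.
    exact: lt_le_trans (q_ge_lo _).
  by have := p_ge (4 * k); lra.
rewrite step_ge ?p_lt// ?step_ge ?q_lt// ?mulr0 ?subr0//.
  by have := q_le_hi (4 * k).+1; lra.
by have := p_le (4 * k).+2; lra.
Qed.

Let cumul_block z k : cumul z (block k) = cumul z (right_step k) - s * cumul z (left_step k).
Proof.
have bi := @bmeas_itv R `]-oo, z].
have := b_right k; have := b_left k => bl br.
rewrite /cumul -meanZ; last bmeas; rewrite -meanB; [|bmeas..].
by congr mean; apply/funext => y; rewrite /block; ring.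
Qed.

Let q01 i : 0 <= q i. Proof. by have := q_ge_lo i; lra. Qed.
Let p01 i : p i <= 1. Proof. by have := p_le i; lra. Qed.
Let q1 i : q i <= 1. Proof. by have := q_le_hi i; lra. Qed.

Let cR_lt k z : z < p (4 * k) -> cumul z (right_step k) = 0.
Proof. by move=> zp; apply: cumul_lt zp; exact: p_lt. Qed.
Let cR_ge k z : p (4 * k).+2 <= z -> cumul z (right_step k) = 0.
Proof. by move=> zp; apply: cumul_ge zp => //; [exact: ltW|exact: p_lt|exact: p_lt]. Qed.
Let cR_mid k z : p (4 * k).+1 <= z < p (4 * k).+2 -> 0 < cumul z (right_step k).
Proof.
move=> zp; have /andP[z1 z2] := zp.
have ppos : 0 < p (4 * k).+2 - p (4 * k).+1 by rewrite subr_gt0 p_lt.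
rewrite (@cumul_mid R _ _ _ (ltW (p_gt0 _)) (p_lt (ltnSn _)) (p_lt (ltnSn _)) (p01 _) z zp).
by rewrite subr_gt0 ltr_pdivrMr// mul1r ltrD2r.
Qed.
Let cL_lt k z : z < q (4 * k).+3 -> cumul z (left_step k) = 0.
Proof. by move=> zp; apply: cumul_lt zp; exact: q_lt. Qed.
Let cL_ge k z : q (4 * k).+1 <= z -> cumul z (left_step k) = 0.
Proof. by move=> zp; apply: cumul_ge zp => //; exact: q_lt. Qed.
Let cL_mid k z : q (4 * k).+2 <= z < q (4 * k).+1 -> 0 < cumul z (left_step k).
Proof.
move=> zp; have /andP[z1 z2] := zp.
have ppos : 0 < q (4 * k).+1 - q (4 * k).+2 by rewrite subr_gt0 q_lt.
rewrite (@cumul_mid R _ _ _ (q01 _) (q_lt (ltnSn _)) (q_lt (ltnSn _)) (q1 _) z zp).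
by rewrite subr_gt0 ltr_pdivrMr// mul1r ltrD2r.
Qed.

(* The position of [dual x] is recorded because [integral_op] applied to a block
   is, up to the rank one term, its primitive evaluated at [dual x]. *)
Variant block_spec k x : R -> Prop :=
  | BlockZero : block_spec k x 0
  | BlockRight1 of p (4 * k) <= x < p (4 * k).+1 & q (4 * k).+1 < dual x <= q (4 * k) :
      block_spec k x (p (4 * k).+1 - p (4 * k))^-1
  | BlockRight2 of p (4 * k).+1 <= x < p (4 * k).+2 & q (4 * k).+2 < dual x <= q (4 * k).+1 :
      block_spec k x (- (p (4 * k).+2 - p (4 * k).+1)^-1)
  | BlockLeft1 of q (4 * k).+3 <= x < q (4 * k).+2 & p (4 * k).+2 < dual x <= p (4 * k).+3 :
      block_spec k x (- s * (q (4 * k).+2 - q (4 * k).+3)^-1)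
  | BlockLeft2 of q (4 * k).+2 <= x < q (4 * k).+1 & p (4 * k).+1 < dual x <= p (4 * k).+2 :
      block_spec k x (s * (q (4 * k).+1 - q (4 * k).+2)^-1).

Lemma blockP k x : block_spec k x (block k x).
Proof.
have dual_lt i j y : p i <= y < p j -> q j < dual y <= q i.
  move=> /andP[iy yj]; have y0 : 0 < y by apply: lt_le_trans iy.
  by rewrite ltr_dual// ler_dual.
have dual_gt i j y : q i <= y < q j -> p j < dual y <= p i.
  move=> /andP[iy yj]; have q0 : 0 < q i by have := q_ge_lo i; lra.
  have y0 : 0 < y by apply: lt_le_trans iy.
  by rewrite -[p j]dualK -[p i]dualK ltr_dual// ler_dual.
rewrite /block /right_step /left_step.
have [xp|px] := ltP x (p (4 * k)); last first.
  rewrite [X in _ - s * X]step_ge ?q_lt// ?mulr0 ?subr0; last first.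
    by have := q_le_hi (4 * k).+1; have := p_ge (4 * k); lra.
  have [x1|x1] := ltP x (p (4 * k).+1).
    have H : p (4 * k) <= x < p (4 * k).+1 by rewrite px.
    by rewrite step_left//; apply: BlockRight1 => //; exact: dual_lt.
  have [x2|x2] := ltP x (p (4 * k).+2).
    have H : p (4 * k).+1 <= x < p (4 * k).+2 by rewrite x1.
    by rewrite step_right//; apply: BlockRight2 => //; exact: dual_lt.
  by rewrite step_ge ?p_lt//; exact: BlockZero.
rewrite step_lt ?p_lt// sub0r -mulNr.
have [x0|x0] := ltP x (q (4 * k).+3).
  by rewrite step_lt ?q_lt// mulr0; exact: BlockZero.
have [x1|x1] := ltP x (q (4 * k).+2).
  have H : q (4 * k).+3 <= x < q (4 * k).+2 by rewrite x0.
  by rewrite step_left//; apply: BlockLeft1 => //; exact: dual_gt.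
have [x2|x2] := ltP x (q (4 * k).+1).
  have H : q (4 * k).+2 <= x < q (4 * k).+1 by rewrite x1.
  by rewrite step_right// mulrNN; apply: BlockLeft2 => //; exact: dual_gt.
by rewrite step_ge ?q_lt// mulr0; exact: BlockZero.
Qed.

(** The density at x of the form at ([block j], [block k]), without its rank one term. *)
Let bump x k j := s * cumul (dual x) (block j) * block k x.

Let bump_cross k j x : j != k -> bump x k j = 0.
Proof.
move=> jk; rewrite /bump cumul_block.
have jk4 : ((4 * j).+3 < 4 * k)%N \/ ((4 * k).+3 < 4 * j)%N.
  by move: jk; rewrite neq_ltn => /orP[|]; [left|right]; lia.
have plt i l : (i < l)%N -> p i < p l by exact: p_lt.
(* The two intervals gather the positions of [dual x] in the nonzero cases of [block_spec]. All
   points of block j lie on one side of each, where its primitives vanish. *)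
have cross z : (q (4 * k).+2 < z <= q (4 * k)) \/ (p (4 * k).+1 < z <= p (4 * k).+3) ->
    cumul z (right_step j) = 0 /\ cumul z (left_step j) = 0.
  move=> [/andP[z1 z2]|/andP[z1 z2]].
    rewrite cR_lt; last by have := q_le_hi (4 * k); have := p_ge (4 * j); lra.
    split=> //; case: jk4 => [jk4|kj4].
      by rewrite cL_lt// (le_lt_trans z2) ?q_lt.
    rewrite cL_ge// (le_trans _ (ltW z1))// ltW// q_lt//; lia.
  rewrite cL_ge; last by have := q_le_hi (4 * j).+1; have := p_ge (4 * k).+1; lra.
  split=> //; case: jk4 => [jk4|kj4].
    rewrite cR_ge// (le_trans _ (ltW z1))// ltW// p_lt//; lia.
  by rewrite cR_lt// (le_lt_trans z2) ?p_lt.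
have crossE z : (q (4 * k).+2 < z <= q (4 * k)) \/ (p (4 * k).+1 < z <= p (4 * k).+3) ->
    cumul z (right_step j) - s * cumul z (left_step j) = 0.
  by move=> /cross[-> ->]; rewrite mulr0 subr0.
case: blockP => [|_ /andP[d1 d2]|_ /andP[d1 d2]|_ /andP[d1 d2]|_ /andP[d1 d2]];
  first by rewrite mulr0.
all: rewrite crossE ?mulr0 ?mul0r//.
- by left; rewrite d2 (lt_trans _ d1)// q_lt.
- by left; rewrite d1 (le_trans d2)// ltW// q_lt.
- by right; rewrite d2 (lt_trans _ d1)// p_lt.
- by right; rewrite d1 (le_trans d2)// ltW// p_lt.
Qed.

Let s_neq0 : s != 0.
Proof. by apply/eqP => s0; move: s2; rewrite s0 mul0r => /eqP; rewrite eq_sym oner_eq0. Qed.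

Let p_gap i : 0 < (p i.+1 - p i)^-1.
Proof. by rewrite invr_gt0 subr_gt0 p_lt. Qed.
Let q_gap i : 0 < (q i - q i.+1)^-1.
Proof. by rewrite invr_gt0 subr_gt0 q_lt. Qed.

Let bump_right k x (g : R) : dual x < p (4 * k) ->
  s * cumul (dual x) (block k) * (- g) = cumul (dual x) (left_step k) * g.
Proof.
by move=> xp; rewrite cumul_block cR_lt// -[RHS]mul1r -s2; ring.
Qed.

(** The left step is shifted by one index, so the rising half of either step reflects beyond the
    support of the other one, where the primitive is zero. Only the falling halves meet, and their
    negative values cancel the minus sign of - s. *)
Let bump_ge0 k x : 0 <= bump x k k.
Proof.
rewrite /bump; case: blockP => [|_ /andP[d1 d2]|_ /andP[d1 d2]|_ /andP[d1 d2]|_ /andP[d1 d2]].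
- by rewrite mulr0.
- rewrite cumul_block cR_lt ?cL_ge ?(ltW d1)// ?mulr0 ?subr0 ?mulr0 ?mul0r//.
  by have := q_le_hi (4 * k); have := p_ge (4 * k); lra.
- rewrite bump_right; last by have := q_le_hi (4 * k).+1; have := p_ge (4 * k); lra.
  rewrite mulr_ge0 ?(ltW (q_gap _) , ltW (p_gap _))//.
  have [d3|d3] := ltP (dual x) (q (4 * k).+1); last by rewrite cL_ge.
  by rewrite ltW// cL_mid// (ltW d1).
- rewrite cumul_block cR_ge ?(ltW d1)// cL_ge ?mulr0 ?subr0 ?mulr0 ?mul0r//.
  by have := q_le_hi (4 * k).+1; have := p_ge (4 * k).+2; lra.
- rewrite cumul_block cL_ge; last by have := q_le_hi (4 * k).+1; have := p_ge (4 * k).+1; lra.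
  rewrite mulr0 subr0 mulrACA s2 mul1r mulr_ge0 ?(ltW (q_gap _))//.
  have [d3|d3] := ltP (dual x) (p (4 * k).+2); last by rewrite cR_ge.
  by rewrite ltW// cR_mid// (ltW d1).
Qed.

Let bump_gt0 k x : p (4 * k).+1 < x < p (4 * k).+2 -> 0 < bump x k k.
Proof.
move=> /andP[x1 x2].
have d1 : q (4 * k).+2 < dual x by rewrite ltr_dual// (lt_trans _ x1).
have d2 : dual x < q (4 * k).+1 by rewrite ltr_dual.
have blockE : block k x = - (p (4 * k).+2 - p (4 * k).+1)^-1.
  rewrite /block /right_step step_right ?(ltW x1)// /left_step step_ge ?q_lt//.
    by rewrite mulr0 subr0.
  by have := q_le_hi (4 * k).+1; have := p_ge (4 * k).+1; lra.
rewrite /bump blockE.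
rewrite bump_right; last by have := q_le_hi (4 * k).+1; have := p_ge (4 * k); lra.
by rewrite mulr_gt0 ?p_gap// cL_mid// (ltW d1).
Qed.

(** The inverse cut off to the window, hence bounded; it agrees with 1/y wherever a block is
    nonzero. *)
Let h y : R := y^-1 * (y \in `[62 / 100, 81 / 100])%:R.

Let bmeas_h : bmeas h.
Proof.
split.
  apply: measurable_funM; first exact: measurable_inv.
  by case: (bmeas_itv `[62 / 100 : R, 81 / 100]).
exists 2 => y; rewrite /h in_itv/=; have [/andP[y1 y2]|_] := boolP (_ && _); last first.
  by rewrite mulr0 normr0.
have y0 : 0 < y by lra.
rewrite mulr1 ger0_norm; last by rewrite invr_ge0 ltW.
by rewrite -[_^-1]mul1r ler_pdivrMr//; lra.
Qed.

Let in_support k x : block k x != 0 -> 62 / 100 <= x <= 81 / 100.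
Proof. by apply: contraR => /support_block ->. Qed.

Let h_near y : 62 / 100 <= y <= 81 / 100 -> h y = y^-1.
Proof. by move=> yD; rewrite /h in_itv/= yD mulr1. Qed.

(** [kernel_frac_near] is integrated against the block: the constant 3/2 disappears because the
    steps have mean zero, the indicator gives the primitive at [dual x], and the product of inverses
    gives the rank one term. *)
Let integral_op_block k x : 62 / 100 <= x <= 81 / 100 ->
  integral_op P (fun x y => s * K x y) (block k) x =
  s * cumul (dual x) (block k) - s * dot (block k) h * x^-1.
Proof.
move=> xD; have bb := bmeas_block k.
have bi := @bmeas_itv R `]-oo, dual x].
have mean0 : mean P (block k) = 0.
  rewrite meanB; [|exact: b_right|by have := b_left k; bmeas].
  rewrite meanZ; last exact: b_left.
  rewrite (@mean_step R _ _ _ (ltW (p_gt0 _)) (p_lt (ltnSn _)) (p_lt (ltnSn _)) (p01 _)).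
  by rewrite (@mean_step R _ _ _ (q01 _) (q_lt (ltnSn _)) (q_lt (ltnSn _)) (q1 _)); ring.
transitivity (mean P (fun y => s * (3 / 2) * block k y +
    (s * ((y \in `]-oo, dual x])%:R * block k y) - s * x^-1 * (block k y * h y)))).
  congr mean; apply/funext => y.
  have [->|/in_support yD] := eqVneq (block k y) 0; first by ring.
  by rewrite kernel_frac_near// h_near//; ring.
have bh := bmeas_h.
rewrite meanD; [|bmeas..]; rewrite meanB; [|bmeas..]; rewrite !meanZ; [|bmeas..].
by rewrite mean0 -/(cumul _ _) -/(dot (block k) h); ring.
Qed.

Lemma measurable_skernel : measurable_fun setT (fun z : R * R => s * K z.1 z.2).
Proof. by apply: measurable_funM => //; exact: measurable_kernel_frac. Qed.

Lemma skernel_le1 x y : `|s * K x y| <= 1.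
Proof.
have -> : `|s * K x y| = `|K x y|.
  rewrite normrM; suff -> : `|s| = 1 by rewrite mul1r.
  by apply/eqP; rewrite -(@eqrXn2 _ 2)// expr1n real_normK ?num_real// expr2 s2.
exact: kernel_frac_le1.
Qed.

Let bumpE i j x : bump x j i =
  integral_op P (fun x y => s * K x y) (block i) x * block j x
    + s * dot (block i) h * (block j x * h x).
Proof.
rewrite /bump; have [->|/in_support xD] := eqVneq (block j x) 0; first by ring.
by rewrite integral_op_block// h_near//; ring.
Qed.

Let bmeas_bump i j : bmeas (fun x => bump x j i).
Proof.
have bbi := bmeas_block i; have bbj := bmeas_block j; have bh := bmeas_h.
have bk := bmeas_integral_op P measurable_skernel skernel_le1 bbi.
by under eq_fun do rewrite bumpE; bmeas.
Qed.

Lemma form_block i j : dot (integral_op P (fun x y => s * K x y) (block i)) (block j) =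
  mean P (fun x => bump x i i) *+ (i == j) + - s * dot (block i) h * dot (block j) h.
Proof.
have bbj := bmeas_block j; have bh := bmeas_h; have bb := bmeas_bump i j.
transitivity (mean P (fun x => bump x j i - s * dot (block i) h * (block j x * h x))).
  by congr mean; apply/funext => x; rewrite bumpE; ring.
rewrite meanB; [|bmeas..]; rewrite meanZ; [|bmeas..].
rewrite -/(dot (block j) h) !mulNr; congr (_ - _).
have [->|ij] := eqVneq i j; first by rewrite mulr1n.
rewrite mulr0n -[RHS](mean_cst P); congr mean; apply/funext => x.
by rewrite bump_cross.
Qed.

Lemma mean_bump_gt0 k : 0 < mean P (fun x => bump x k k).
Proof.
have plt := p_lt (ltnSn (4 * k).+1).
(* Starting at the midpoint keeps the half-open interval of [mean_gt0] inside the open one of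
   [bump_gt0]. *)
apply: (@mean_gt0 _ _ ((p (4 * k).+1 + p (4 * k).+2) / 2) (p (4 * k).+2)) => //.
- by have := p_gt0 (4 * k).+1; lra.
- by lra.
- by move=> x /andP[x1 x2]; apply: bump_gt0; rewrite x2 andbT; lra.
Qed.

Lemma infinitely_many_signed_eigenvalues :
  infinite_set (eigenvalues K `&` [set (s * r)%:C%C | r in `]0, +oo[]).
Proof.
have inf := @infinitely_many_eigenvalues _ _ _ P (fun x y => s * K x y)
  measurable_skernel _ skernel_le1 (@rat_enum R) _ block h (- s)
  (fun k => mean P (fun x => bump x k k)) bmeas_block bmeas_h mean_bump_gt0 form_block.
apply: contra_not (inf _ _).
- move=> fin.
  (* This map undoes the passage from nu to s / nu, so finitely many eigenvalues of this sign would
     leave finitely many nu. *)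
  have : finite_set ((fun z : R[i] => s / complex.Re z) @`
      (eigenvalues K `&` [set (s * r)%:C%C | r in `]0, +oo[])) by exact: finite_image.
  apply: sub_finite_set => nu [nu0 [f [bf f1 ef]]].
  exists (s / nu)%:C%C; last by rewrite /= invf_div mulrCA mulfV// mulr1.
  split; first by apply: eigenvalue_transfer ef => //; rewrite gt_eqF.
  by exists nu^-1 => //; rewrite /= in_itv/= andbT invr_gt0.
- by move=> x y; rewrite kernel_frac_sym.
- move=> x e e0; have [i di] := kernel_frac_dense x e0; exists i.
  rewrite (le_lt_trans _ di)// le_eqVlt; apply/orP; left; apply/eqP.
  congr mean; apply/funext => y.
  by rewrite -mulrBr mulrACA s2 mul1r.
Qed.

End Blocks.

Local Open Scope complex_scope.

Theorem theorem1 (R : realType) :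
  infinite_set (eigenvalues (@kernel_frac R) `&` [set r%:C | r in `]-oo, 0[]) /\
  infinite_set (eigenvalues (@kernel_frac R) `&` [set r%:C | r in `]0, +oo[]).
Proof.
(* An increasing sequence from 72/100 with limit 80/100, the two ends of the allowed range. *)
pose p i : R := 8 / 10 - 8 / 100 * i.+1%:R^-1.
have p_bounds i : 72 / 100 <= p i <= 80 / 100.
  have i0 : 0 < i.+1%:R^-1 :> R by rewrite invr_gt0.
  have i1 : i.+1%:R^-1 <= 1 :> R by rewrite invf_le1// ler1n.
  rewrite /p; move: (_^-1) i0 i1 => t t0 t1; apply/andP; split; lra.
have p_lt i j : (i < j)%N -> p i < p j.
  move=> ij; rewrite /p ltrD2l ltrN2 ltr_pM2l; last by lra.
  by rewrite ltf_pV2 ?posrE// ltr_nat.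
split.
- have := @infinitely_many_signed_eigenvalues R p p_bounds p_lt (-1) _.
  rewrite mulrNN mulr1 => /(_ erefl); congr (infinite_set (_ `&` _)).
  apply/seteqP; split=> _ [r /= + <-]; rewrite in_itv/= ?andbT => r0; exists (- r);
    by rewrite ?in_itv/= ?oppr_gt0 ?oppr_lt0 ?mulN1r ?opprK ?andbT.
- have := @infinitely_many_signed_eigenvalues R p p_bounds p_lt 1 (mulr1 1).
  congr (infinite_set (_ `&` _)).
  by apply/seteqP; split=> _ [r r0 <-]; exists r => //; rewrite mul1r.
Qed.
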